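(* Let $c\in(0,1]$ and let $n=n(p)$ be a function of $p$ with $n\ge p$ such that $p/n\to c$ as $p\to\infty$. Let $\mathbf{X}$ be either the $p\times n$ random Toeplitz matrix or the $p\times n$ random rectangular circulant matrix (both defined in the context), and let $\lambda_p$ be the smallest eigenvalue of $\mathbf{S}=\frac1n\mathbf{X}\mathbf{X}^\top$. Then, in both the Toeplitz and the circulant case, there exists a constant $\beta>0$, which may depend on $c$, such that $$\lambda_p=o_{\mathrm P}\left(\exp\left\{-\beta\log^{1/3}(p)\right\}\right)\quad\text{as } p\to\infty .$$
   Context: Let $x_i$, $i\in\mathbb{Z}$, be i.i.d. standard normal real random variables. For $n\ge p$, the random Toeplitz matrix is the $p\times n$ matrix $\mathbf{X}=(x_{j-i})_{1\le i\le p,\,1\le j\le n}$. The random rectangular circulant matrix is the $p\times n$ matrix $\mathbf{X}=(x_{(j-i)\bmod n})_{1\le i\le p,\,1\le j\le n}$, where $(j-i)\bmod n\in\{0,\dots,n-1\}$ (so its first row is $(x_0,x_1,\dots,x_{n-1})$ and each subsequent row is the cyclic right shift of the previous one). For random variables $\xi_p$ and positive numbers $a_p$, $\xi_p=o_{\mathrm P}(a_p)$ means $\xi_p/a_p\to0$ in probability. Here $\log^{1/3}(p)=(\log p)^{1/3}$. *)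

(* Defs.v *)
From HB Require Import structures.
From mathcomp Require Import all_boot all_order all_algebra.
From mathcomp Require Import all_classical all_reals all_analysis.

Set Implicit Arguments.
Unset Strict Implicit.
Unset Printing Implicit Defensive.

Import Order.TTheory GRing.Theory Num.Theory.
Import numFieldNormedType.Exports.

Local Open Scope classical_set_scope.
Local Open Scope ring_scope.

Definition mutually_independent {d : measure_display} {T : measurableType d}
    {R : realType} (P : probability T R) {I : choiceType}
    (x : I -> {RV P >-> R}) : Prop :=
  forall (s : seq I) (B : I -> set R), uniq s ->
    (forall i, i \in s -> measurable (B i)) ->
    P (\bigcap_(i in [set` s]) (x i @^-1` B i)) =
    (\prod_(i <- s) P (x i @^-1` B i))%E.

Definition iid_std_normal {d : measure_display} {T : measurableType d}
    {R : realType} (P : probability T R) {I : choiceType}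
    (x : I -> {RV P >-> R}) : Prop :=
  mutually_independent x /\
  forall (i : I) (B : set R), measurable B ->
    distribution P (x i) B = normal_prob 0 1 B.

(* Only differences of indices matter, so rows and columns are numbered
   from 0. *)
Definition toeplitz_mx {R : realType} (p n : nat) (x : int -> R) :
    'M[R]_(p, n) :=
  \matrix_(i < p, j < n) x (j%:Z - i%:Z).

(* [modz] takes values in {0, ..., n - 1} for n > 0. *)
Definition circulant_mx {R : realType} (p n : nat) (x : int -> R) :
    'M[R]_(p, n) :=
  \matrix_(i < p, j < n) x (modz (j%:Z - i%:Z) n%:Z).

Definition sample_cov {R : realType} (p n : nat) (X : 'M[R]_(p, n)) : 'M[R]_p :=
  n%:R^-1 *: (X *m X^T).

(* The set of eigenvalues is finite, and nonempty when A is symmetric and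
   p > 0, so that the infimum is then a minimum. *)
Definition smallest_eigenvalue {R : realType} (p : nat) (A : 'M[R]_p) : R :=
  inf [set a : R | eigenvalue A a].

Definition cvg_in_probability {d : measure_display} {T : measurableType d}
    {R : realType} (P : probability T R) (xi : nat -> T -> R) (l : R) : Prop :=
  forall eps : R, 0 < eps ->
    P [set w | eps < `|xi p w - l|] @[p --> \oo] --> 0%E.

Definition littleo_P {d : measure_display} {T : measurableType d}
    {R : realType} (P : probability T R) (xi : nat -> T -> R)
    (a : nat -> R) : Prop :=
  cvg_in_probability P (fun p w => xi p w / a p) 0.

Variant ensemble := Toeplitz | Circulant.

Definition ensemble_mx (e : ensemble) {R : realType} (p n : nat)
    (x : int -> R) : 'M[R]_(p, n) :=
  match e with
  | Toeplitz => toeplitz_mx p n x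
  | Circulant => circulant_mx p n x
  end.

(* Main.v *)
Require Import Defs.
From HB Require Import structures.
From mathcomp Require Import all_boot all_order all_algebra.
From mathcomp Require Import all_classical all_reals all_analysis.
From mathcomp Require Import measurable_realfun.
From mathcomp Require Import complex.
From mathcomp Require cyclic separable cyclotomic.
From mathcomp Require Import ring lra.

(** The vector X^T v is a convolution of v with the noise x, so in frequency
    the Rayleigh quotient at v is an average of |x^(k)|^2 with weights
    |v^(k)|^2.  When v^ is concentrated on a short window of frequencies, the
    quotient is small as soon as the noise is small on that window.  There are
    about as many windows as columns, they are nearly independent, and hence
    one of them is atypically good.

    Both ensembles live inside a square circulant matrix of order N = O(p)
    ([ensemble_embedding]): a Toeplitz matrix is a block of columns of a
    circulant one, and deleting columns only decreases |X^T v|.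

    The test vectors are the coefficients of (1 + X + ... + X^(l-1))^(m+1) with
    l about p/m, modulated to a frequency k0.  Their Fourier transform is a
    power of the Dirichlet kernel.  The window consists of the frequencies where
    the kernel exceeds half its maximum; by Parseval there are at most
    4 N / l = O(m) of them, and elsewhere the squared transform is smaller than
    its peak by a factor 4^-m.  With H the real (Hartley) Fourier coefficients
    of the noise and Q the sum of H_k^2 over the window, this bounds the
    smallest eigenvalue by a constant times Q + m 4^-m max_k H_k^2
    ([lam_le_window]).

    The Hartley matrix is orthogonal, so the H_k behave like independent
    standard normal variables ([expectation_gauss_tilt]).  In particular
    exp(- s Q / 2) has mean (1 + s)^(- r / 2) for a window of size r, and
    disjoint windows are uncorrelated.  The second moment method applied to the
    sum over all windows shows that, outside an event of probability
    O(m^2 (1 + s)^O(m) / N), some window satisfies Q <= O(m ln(1 + s)) / s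
    ([circulant_small_ball]); moreover all |H_k| are at most 2 ln N with high
    probability.

    With s = 4^m and m about (ln p)^(1/3), the exceptional probability is
    exp(O(m^2) - m^3), while the eigenvalue is at most 4^-m times a polynomial
    in m, which is negligible compared with exp(- m / 4)
    ([smallest_eigenvalue_rate]).  Finally, the smallest eigenvalue is the
    minimum of the Rayleigh quotient ([smallest_eigenvalue_rayleigh]); this gives
    the comparison with test vectors and also the measurability of the events
    in the statement. *)

Set Implicit Arguments.
Unset Strict Implicit.
Unset Printing Implicit Defensive.

Import Order.TTheory GRing.Theory Num.Theory.
Import numFieldNormedType.Exports.

Local Open Scope classical_set_scope.
Local Open Scope ring_scope.

(** * Integration under a weight, Gaussian integrals and independence *)

Lemma tonelli_curried {R : realType} {d1 d2 : measure_display}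
    {T1 : measurableType d1} {T2 : measurableType d2}
    (m1 : {sigma_finite_measure set T1 -> \bar R})
    (m2 : {sigma_finite_measure set T2 -> \bar R}) (f : T1 -> T2 -> R) :
  measurable_fun setT (fun z : T1 * T2 => f z.1 z.2) ->
  (forall x y, 0 <= f x y) ->
  (\int[m1]_x \int[m2]_y (f x y)%:E = \int[m2]_y \int[m1]_x (f x y)%:E)%E.
Proof.
move=> mf f0; apply: (fubini_tonelli (fun z => (f z.1 z.2)%:E)).
- exact/measurable_EFinP.
- by move=> z; rewrite lee_fin.
Qed.

(** Layer cake: f is the integral over u >= 0 of the indicators of [u < f], so
    Tonelli's theorem carries the hypothesis from indicators over to f.  It
    serves to integrate against the normal density, and to treat independent
    variables one at a time. *)
Lemma integral_under_weight {R : realType} {d d' : measure_display}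
    {T : measurableType d} {T' : measurableType d'}
    (mu : {sigma_finite_measure set T -> \bar R})
    (nu : {sigma_finite_measure set T' -> \bar R})
    (F : T -> R) (X : T -> T') (K : R) (f : T' -> R) :
  (forall w, 0 <= F w) -> measurable_fun setT F -> measurable_fun setT X ->
  0 <= K ->
  (forall B, measurable B ->
     (\int[mu]_w (F w * \1_B (X w))%:E = K%:E * nu B)%E) ->
  (forall t, 0 <= f t) -> measurable_fun setT f ->
  (\int[mu]_w (F w * f (X w))%:E = K%:E * \int[nu]_t (f t)%:E)%E.
Proof.
move=> F0 mF mX K0 FB f0 mf.
pose leb := @lebesgue_measure R.
pose g t u : R := \1_(`[0, f t[) u.
have intg t : (\int[leb]_u (g t u)%:E = (f t)%:E)%E.
  rewrite integral_indic//= setIT /leb lebesgue_measure_itv/=.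
  by case: ifPn => //; rewrite ?oppr0 ?adde0// -leNgt lee_fin => h;
     congr EFin; apply/eqP; rewrite eq_le h f0.
pose S : set (T' * R) := [set z | 0 <= z.2 < f z.1].
have gS t u : g t u = \1_S (t, u).
  by rewrite /g !indicE; congr (nat_of_bool _)%:R; apply/idP/idP;
     rewrite !inE /S /= in_itv/=.
have mS : measurable S.
  rewrite (_ : S = (fun z => (0 <= z.2) && (z.2 < f z.1)) @^-1` [set true]).
    rewrite -[X in measurable X]setTI.
    apply: measurable_and => //; first exact: measurable_fun_ler.
    apply: measurable_fun_ltr => //; exact: measurableT_comp.
  by apply/seteqP; split => z.
have mg2 : measurable_fun setT (fun z : T' * R => g z.1 z.2).
  rewrite (_ : (fun _ => _) = \1_S); first exact: measurable_indic.
  by apply/funext => -[t u]; rewrite gS.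
have g0 t u : 0 <= g t u by [].
transitivity (\int[mu]_w \int[leb]_u (F w * g (X w) u)%:E)%E.
  apply: eq_integral => w _.
  under [RHS]eq_integral do rewrite EFinM.
  rewrite ge0_integralZl//=.
  - by rewrite intg EFinM.
  - by apply/measurable_EFinP; exact: measurable_indic.
  - by move=> u _; rewrite lee_fin.
  - by rewrite lee_fin.
rewrite (tonelli_curried mu leb (f := fun w u => F w * g (X w) u)); last 2 first.
- apply: measurable_funM.
    exact: measurableT_comp.
  have mXu : measurable_fun setT (fun z : T * R => (X z.1, z.2)).
    by apply: measurable_fun_pair => //; exact: (measurableT_comp mX).
  exact: (measurableT_comp mg2 mXu).
- by move=> w u; rewrite mulr_ge0.
transitivity (\int[leb]_u (K%:E * \int[nu]_t (g t u)%:E))%E.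
  apply: eq_integral => u _.
  have mSu : measurable (ysection S u) by exact: measurable_ysection.
  have gE t : g t u = \1_(ysection S u) t.
    rewrite gS !indicE; congr (nat_of_bool _)%:R.
    by rewrite mem_ysection.
  under eq_integral do rewrite gE.
  rewrite FB//.
  under [in RHS]eq_integral do rewrite gE.
  by rewrite integral_indic//= setIT.
rewrite ge0_integralZl//=.
- rewrite -(tonelli_curried nu leb mg2)//.
  + by congr (_ * _)%E; apply: eq_integral => t _; rewrite intg.
- apply: (measurable_fun_fubini_tonelli_G (m1 := nu) (fun z : T' * R => (g z.1 z.2)%:E)) => //=.
  + by apply/measurable_EFinP.
  + by move=> z; rewrite lee_fin.
- by move=> u _; apply: integral_ge0 => t _; rewrite lee_fin.
Qed.

Lemma integral_std_normal {R : realType} (f : R -> R) :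
  (forall t, 0 <= f t) -> measurable_fun setT f ->
  (\int[normal_prob 0 1]_t (f t)%:E =
   \int[lebesgue_measure]_t (normal_pdf 0 1 t * f t)%:E)%E.
Proof.
move=> f0 mf.
rewrite (@integral_under_weight _ _ _ _ _ lebesgue_measure (normal_prob 0 1)
  (normal_pdf 0 1) id 1 f) ?mul1e//.
- by move=> t; exact: normal_pdf_ge0.
- exact: measurable_normal_pdf.
move=> B mB; rewrite mul1e /normal_prob [RHS]integral_mkcond/=.
apply: eq_integral => t _; rewrite patchE indicE.
by case: ifPn => _; rewrite ?mulr1// mulr0.
Qed.

Lemma normal_peak_scale {R : realType} (s : R) : 0 < s ->
  normal_peak s = normal_peak 1 * s^-1.
Proof.
move=> s0; rewrite /normal_peak expr1n mul1r -mulrnAr.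
by rewrite sqrtrM ?sqr_ge0// sqrtr_sqr gtr0_norm// invfM mulrC.
Qed.

Lemma normal_pdf_expR {R : realType} (m s t : R) : 0 < s ->
  normal_pdf m s t = normal_peak 1 * s^-1 * expR (- ((t - m) ^+ 2 / (s ^+ 2 * 2))).
Proof.
move=> s0; rewrite normal_pdfE ?gt_eqF// normal_peak_scale// /normal_fun.
by rewrite mulr_natr mulNr.
Qed.

(** Completing the square turns the integrand times the standard normal density
    into a multiple of another normal density. *)
Lemma integral_std_normal_expR {R : realType} (b c : R) : 0 <= b ->
  (\int[normal_prob 0 1]_t (expR (- (b / 2) * t ^+ 2 + c * t))%:E =
   ((Num.sqrt (1 + b))^-1 * expR (c ^+ 2 / (2 * (1 + b))))%:E)%E.
Proof.
move=> b0; rewrite integral_std_normal; last 2 first.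
- by move=> t; exact: expR_ge0.
- apply: measurableT_comp => //; apply: measurable_funD.
    by apply: measurable_funM => //; exact: measurable_funX.
  exact: measurable_funM.
have b1 : 0 < 1 + b by rewrite ltr_pwDl.
have q0 : 0 < Num.sqrt (1 + b) by rewrite sqrtr_gt0.
have qE : Num.sqrt (1 + b) ^+ 2 = 1 + b by rewrite sqr_sqrtr ?ltW.
set q := Num.sqrt (1 + b) in q0 qE *.
set C := q^-1 * expR _.
transitivity (\int[lebesgue_measure]_t (C%:E * (normal_pdf (c / (1 + b)) q^-1 t)%:E))%E.
  apply: eq_integral => t _; rewrite -EFinM; congr EFin.
  rewrite !normal_pdf_expR ?invr_gt0//.
  move: (normal_peak 1) => pk; rewrite /C invr1 invrK mulr1.
  have -> (u v w : R) : u * expR v * expR w = u * expR (v + w).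
    by rewrite -mulrA -expRD.
  have -> (u v w z : R) : u * expR v * (w * expR z) = u * w * expR (v + z).
    by rewrite expRD; ring.
  rewrite (_ : q^-1 * (pk * q) = pk); last by field; rewrite gt_eqF.
  congr (_ * expR _).
  rewrite exprVn qE; field.
  by rewrite gt_eqF.
rewrite ge0_integralZl//=.
- by rewrite integral_normal_pdf mule1.
- by apply/measurable_EFinP; exact: measurable_normal_pdf.
- by move=> t _; rewrite lee_fin normal_pdf_ge0.
- by rewrite lee_fin mulr_ge0 ?invr_ge0 ?expR_ge0 ?ltW.
Qed.

Section independence.
Context {R : realType} {d : measure_display} {T : measurableType d}.
Context (P : probability T R) {I : choiceType} (x : I -> {RV P >-> R}).
Hypothesis iid : iid_std_normal x.

(** The product of the indicators is the indicator of the intersection, whose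
    probability is given by mutual independence. *)
Let prod_indic_aux (s : seq I) (g : I -> R -> R) (k : I -> R) : uniq s ->
  (forall i, measurable_fun setT (g i)) ->
  (forall i, i \in s -> exists B, g i = \1_B) ->
  (forall i, i \in s -> \int[normal_prob 0 1]_t (g i t)%:E = (k i)%:E)%E ->
  (\int[P]_w (\prod_(i <- s) g i (x i w))%:E = (\prod_(i <- s) k i)%:E)%E.
Proof.
move=> us mg gB gk.
pose B i := g i @^-1` [set 1].
have mB i : measurable (B i).
  by rewrite -[B i]setTI; apply: mg => //; exact: measurable_set1.
have gE i : i \in s -> g i = \1_(B i).
  move=> /gB[A gA]; rewrite {1}gA; congr (\1_ _).
  apply/seteqP; split => t; rewrite /B /preimage/= gA indicE.
    by move/mem_set => ->.
  by case: (boolP (t \in A)) => [/set_mem//|_ /eqP]; rewrite eq_sym oner_eq0.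
transitivity (\int[P]_w (\1_(\bigcap_(i in [set` s]) (x i @^-1` B i)) w)%:E)%E.
  apply: eq_integral => w _; congr EFin; rewrite indicE bigcap_seq.
  have -> : \prod_(i <- s) g i (x i w) = \prod_(i <- s) \1_(B i) (x i w).
    by apply: eq_big_seq => i si; rewrite gE.
  elim: {us gB gk gE} s => [|i s IH]; first by rewrite !big_nil in_setT.
  rewrite !big_cons IH in_setI indicE -natrM mulnb; congr (nat_of_bool (_ && _))%:R.
rewrite [LHS]integral_indic//; last first.
  rewrite bigcap_seq.
  apply: bigsetI_measurable => i _.
  by rewrite -[_ @^-1` _]setTI; exact: measurable_funP.
rewrite setIT -prodEFin.
transitivity (\prod_(i <- s) P (x i @^-1` B i))%E; first exact: iid.1.
apply: eq_big_seq => i si.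
rewrite -gk// gE// integral_indic//= ?setIT.
  exact: (iid.2 i (B i) (mB i)).
exact: mB.
Qed.

(** Independence is a property of events; [integral_under_weight] upgrades one
    factor after the other from an indicator to a nonnegative function. *)
Lemma expectation_prod (s : seq I) (g : I -> R -> R) (k : I -> R) : uniq s ->
  (forall i t, 0 <= g i t) ->
  (forall i, measurable_fun setT (g i)) ->
  (forall i, i \in s -> \int[normal_prob 0 1]_t (g i t)%:E = (k i)%:E)%E ->
  (\int[P]_w (\prod_(i <- s) g i (x i w))%:E = (\prod_(i <- s) k i)%:E)%E.
Proof.
move=> us g0 mg gk.
(* The indices in s2 already carry indicators, those in s1 are still free. *)
suff : forall s1 s2 (g : I -> R -> R) (k : I -> R), uniq (s1 ++ s2) ->
  (forall i t, 0 <= g i t) ->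
  (forall i, measurable_fun setT (g i)) ->
  (forall i, i \in s2 -> exists B, g i = \1_B) ->
  (forall i, i \in s1 ++ s2 -> \int[normal_prob 0 1]_t (g i t)%:E = (k i)%:E)%E ->
  (\int[P]_w (\prod_(i <- s1 ++ s2) g i (x i w))%:E =
     (\prod_(i <- s1 ++ s2) k i)%:E)%E.
  by move=> /(_ s [::] g k); rewrite cats0; apply.
elim {s us g g0 mg k gk} => [|i s1 IH] s2 g k us g0 mg gB gk.
  exact: prod_indic_aux.
have k0 j : j \in (i :: s1) ++ s2 -> 0 <= k j.
  by move=> js; rewrite -lee_fin -gk//; apply: integral_ge0 => t _; rewrite lee_fin.
move: (us); rewrite cat_cons cons_uniq => /andP[inot us'].
rewrite big_cons.
under eq_integral do rewrite big_cons mulrC.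
have -> : (k i * \prod_(j <- s1 ++ s2) k j)%:E =
    ((\prod_(j <- s1 ++ s2) k j)%:E * \int[normal_prob 0 1]_t (g i t)%:E)%E.
  by rewrite gk ?inE ?eqxx// -EFinM mulrC.
apply: (@integral_under_weight _ _ _ _ _ P (normal_prob 0 1)
  (fun w => \prod_(j <- s1 ++ s2) g j (x j w)) (x i) _ (g i)) => //.
- by move=> w; apply: prodr_ge0.
- apply: measurable_prod => j _; apply: measurableT_comp => //.
- exact (@measurable_funPT _ _ _ _ (x i)).
- by rewrite big_seq; apply: prodr_ge0 => j js; apply: k0; rewrite inE js orbT.
move=> B mB.
(* Replacing g i by an indicator moves i from s1 to s2. *)
pose g' j := if j == i then \1_B : R -> R else g j.
pose k' j := if j == i then fine (normal_prob 0 1 B) else k j.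
have pe : perm_eq (s1 ++ i :: s2) (i :: s1 ++ s2).
  by rewrite -(cat1s i s2) perm_catCA.
have ne j : j \in s1 ++ s2 -> (j == i) = false.
  by move=> js; apply/negP => /eqP ji; move: inot; rewrite -ji js.
have IH' : (\int[P]_w (\prod_(j <- s1 ++ i :: s2) g' j (x j w))%:E =
    (\prod_(j <- s1 ++ i :: s2) k' j)%:E)%E.
  apply: IH.
  - by rewrite (perm_uniq pe).
  - by move=> j t; rewrite /g'; case: ifP.
  - by move=> j; rewrite /g'; case: ifP => _ //; exact: measurable_indic.
  - move=> j; rewrite inE /g'; case: eqP => /= [_ _|_ js]; first by exists B.
    exact: gB.
  - move=> j; rewrite (perm_mem pe) inE /g' /k'; case: eqP => /= [_ _|_ js].
      by rewrite integral_indic//= setIT fineK// fin_num_measure.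
    by apply: gk; rewrite inE js orbT.
transitivity (\int[P]_w (\prod_(j <- s1 ++ i :: s2) g' j (x j w))%:E)%E.
  apply: eq_integral => w _; congr EFin.
  rewrite (perm_big _ pe) big_cons {1}/g' eqxx mulrC; congr (_ * _).
  by apply: eq_big_seq => j js; rewrite /g' ne.
rewrite IH' (perm_big _ pe) big_cons {1}/k' eqxx.
rewrite /= mulrC EFinM fineK ?fin_num_measure//; congr (_%:E * _)%E.
by apply: eq_big_seq => j js; rewrite /k' ne.
exact: mg.
Qed.

End independence.

(** * Gaussian vectors under an orthogonal change of coordinates *)

(** A family of test functions rich enough for the whole argument: closed under
    products, with explicit normal expectations, and positive, so that Tonelli's
    theorem needs no integrability. *)
Definition gauss_tilt {R : realType} (s a t : R) : R :=
  expR (- (s / 2) * t ^+ 2 + a * t).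

Definition gauss_tilt_mean {R : realType} (s a : R) : R :=
  (Num.sqrt (1 + s))^-1 * expR (a ^+ 2 / (2 * (1 + s))).

Lemma measurable_gauss_tilt {R : realType} (s a : R) :
  measurable_fun setT (gauss_tilt s a).
Proof.
apply: measurableT_comp => //; apply: measurable_funD.
  by apply: measurable_funM => //; exact: measurable_funX.
exact: measurable_funM.
Qed.

Lemma gauss_tilt_ge0 {R : realType} (s a t : R) : 0 <= gauss_tilt s a t.
Proof. exact: expR_ge0. Qed.

Lemma gauss_tilt_mean_ge0 {R : realType} (s a : R) : 0 <= gauss_tilt_mean s a.
Proof. by rewrite mulr_ge0 ?expR_ge0// invr_ge0 sqrtr_ge0. Qed.

Lemma integral_gauss_tilt {R : realType} (s a : R) : 0 <= s ->
  (\int[normal_prob 0 1]_t (gauss_tilt s a t)%:E = (gauss_tilt_mean s a)%:E)%E.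
Proof. exact: integral_std_normal_expR. Qed.

(** exp((S - s) t^2 / 2) is the Laplace transform of the standard normal law at
    sqrt(S - s) t, so a tilt with the weaker damping s is a normal mixture of
    tilts with the stronger damping S. *)
Lemma gauss_tilt_mixture {R : realType} (S s a t : R) : s <= S ->
  (\int[normal_prob 0 1]_u (gauss_tilt S (a + Num.sqrt (S - s) * u) t)%:E =
   (gauss_tilt s a t)%:E)%E.
Proof.
move=> sS; set D := Num.sqrt (S - s).
have DE : D ^+ 2 = S - s by rewrite sqr_sqrtr ?subr_ge0.
under eq_integral => u _.
  rewrite (_ : gauss_tilt S (a + D * u) t =
               gauss_tilt S a t * gauss_tilt 0 (D * t) u); last first.
    by rewrite /gauss_tilt -expRD; congr expR; ring.
  rewrite EFinM; over.
rewrite ge0_integralZl//=.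
- rewrite integral_gauss_tilt// -EFinM /gauss_tilt_mean /gauss_tilt addr0.
  rewrite sqrtr1 invr1 mul1r -expRD; congr (expR _)%:E.
  by rewrite exprMn DE mulr1; lra.
- by apply/measurable_EFinP; exact: measurable_gauss_tilt.
- by move=> u _; rewrite lee_fin gauss_tilt_ge0.
- by rewrite lee_fin gauss_tilt_ge0.
Qed.

Lemma measurable_gauss_tilt_pair {R : realType} {d : measure_display}
    {T : measurableType d} (S a D : R) (h : T -> R) : measurable_fun setT h ->
  measurable_fun setT
    (fun z : T * R => gauss_tilt S (a + D * z.2) (h z.1)).
Proof.
move=> mh; have mh1 : measurable_fun setT (fun z : T * R => h z.1).
  exact: (measurableT_comp mh measurable_fst).
apply: measurableT_comp => //; apply: measurable_funD.
  by apply: measurable_funM => //; exact: measurable_funX.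
apply: measurable_funM => //; apply: measurable_funD => //.
exact: measurable_funM.
Qed.

Lemma gauss_tilt_mean_mixture {R : realType} (S s a : R) : 0 <= s <= S ->
  (\int[normal_prob 0 1]_u (gauss_tilt_mean S (a + Num.sqrt (S - s) * u))%:E =
   (gauss_tilt_mean s a)%:E)%E.
Proof.
move=> /andP[s0 sS]; set D := Num.sqrt (S - s).
have S0 : 0 <= S := le_trans s0 sS.
under eq_integral do rewrite -integral_gauss_tilt//.
rewrite -(tonelli_curried (normal_prob 0 1) (normal_prob 0 1)
  (f := fun t u => gauss_tilt S (a + D * u) t)).
- under eq_integral do rewrite gauss_tilt_mixture//.
  exact: integral_gauss_tilt.
- exact: (@measurable_gauss_tilt_pair _ _ _ S a D id).
- by move=> t u; exact: gauss_tilt_ge0.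
Qed.

Lemma sumsq_orthogonal {R : realType} (n : nat) (O : 'M[R]_n) (u : 'I_n -> R) :
  O^T *m O = 1%:M ->
  \sum_k (\sum_j O k j * u j) ^+ 2 = \sum_j u j ^+ 2.
Proof.
move=> OO; pose U : 'cV[R]_n := \col_j u j.
have sq (V : 'cV[R]_n) : \sum_k V k 0 ^+ 2 = (V^T *m V) 0 0.
  by rewrite mxE; apply: eq_bigr => k _; rewrite mxE expr2.
transitivity (\sum_k (O *m U) k 0 ^+ 2).
  apply: eq_bigr => k _; rewrite mxE; congr (_ ^+ 2).
  by apply: eq_bigr => j _; rewrite mxE.
rewrite sq trmx_mul mulmxA -(mulmxA U^T) OO mulmx1 -sq.
by apply: eq_bigr => j _; rewrite mxE.
Qed.

Lemma measurable_RV {R : realType} {d : measure_display} {T : measurableType d}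
    {P : probability T R} (X : {RV P >-> R}) : measurable_fun setT X.
Proof. exact: (@measurable_funPT _ _ _ _ X). Qed.

Section orthogonal_transform.
Context {R : realType} {d : measure_display} {T : measurableType d}.
Context (P : probability T R) (n : nat) (x : 'I_n -> {RV P >-> R}).
Hypothesis iid : iid_std_normal x.
Variable O : 'M[R]_n.
Hypothesis OO : O *m O^T = 1%:M.

Definition mx_coord (k : 'I_n) (w : T) : R := \sum_j O k j * x j w.

Lemma measurable_mx_coord k : measurable_fun setT (mx_coord k).
Proof.
apply: measurable_sum => j; apply: measurable_funM => //.

Qed.

Lemma sumsq_mx_coord w : \sum_k mx_coord k w ^+ 2 = \sum_j x j w ^+ 2.
Proof. by apply: sumsq_orthogonal; exact: mulmx1C. Qed.

(** A constant damping S only involves the squared norm, which the orthogonal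
    matrix preserves, so that the integrand is again a product over the
    independent variables x_j. *)
Let joint_const (S : R) (al : 'I_n -> R) : 0 <= S ->
  (\int[P]_w (\prod_k gauss_tilt S (al k) (mx_coord k w))%:E =
   (\prod_k gauss_tilt_mean S (al k))%:E)%E.
Proof.
move=> S0; pose a j := \sum_k O k j * al k.
have prodE (u v : 'I_n -> R) : \prod_k gauss_tilt S (u k) (v k) =
    expR (- (S / 2) * (\sum_k v k ^+ 2) + \sum_k u k * v k).
  by rewrite -expR_sum; congr expR; rewrite mulr_sumr -big_split.
have aE : \sum_j a j ^+ 2 = \sum_k al k ^+ 2.
  rewrite -(@sumsq_orthogonal R n O^T al) ?trmxK//.
  apply: eq_bigr => j _; congr (_ ^+ 2).
  by apply: eq_bigr => k _; rewrite mxE.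
transitivity (\int[P]_w (\prod_j gauss_tilt S (a j) (x j w))%:E)%E.
  apply: eq_integral => w _; congr EFin; rewrite !prodE sumsq_mx_coord.
  congr (expR (_ + _)).
  under eq_bigr do rewrite mulr_sumr.
  rewrite exchange_big/=; apply: eq_bigr => j _; rewrite mulr_suml.
  by apply: eq_bigr => k _; ring.
rewrite (@expectation_prod _ _ _ _ _ x iid (index_enum 'I_n)
  (fun j => gauss_tilt S (a j)) (fun j => gauss_tilt_mean S (a j))).
- congr EFin; rewrite !big_split/= -!expR_sum; congr (_ * expR _).
  by rewrite -!mulr_suml aE.
- exact: index_enum_uniq.
- by move=> j t; exact: gauss_tilt_ge0.
- by move=> j; exact: measurable_gauss_tilt.
- by move=> j _; exact: integral_gauss_tilt.
Qed.

(** The coordinates of a standard Gaussian vector in an orthonormal basis are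
    independent standard normal variables; this is that fact, tested on
    exponential tilts.  No change of variables in dimension n is needed: for a
    common damping S it is rotation invariance, and [gauss_tilt_mixture] then
    lowers the dampings one coordinate at a time. *)
Lemma expectation_gauss_tilt (sg al : 'I_n -> R) : (forall k, 0 <= sg k) ->
  (\int[P]_w (\prod_k gauss_tilt (sg k) (al k) (mx_coord k w))%:E =
   (\prod_k gauss_tilt_mean (sg k) (al k))%:E)%E.
Proof.
move=> sg0; pose S := \sum_k sg k.
have S0 : 0 <= S by exact: sumr_ge0.
have sgS k : sg k <= S.
  by rewrite /S (bigD1 k)//= lerDl sumr_ge0.
(* r lists the coordinates whose damping may differ from S. *)
suff : forall (r : seq 'I_n) (sg al : 'I_n -> R), (forall k, 0 <= sg k <= S) ->
  (forall k, k \notin r -> sg k = S) ->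
  (\int[P]_w (\prod_k gauss_tilt (sg k) (al k) (mx_coord k w))%:E =
   (\prod_k gauss_tilt_mean (sg k) (al k))%:E)%E.
  move=> /(_ (index_enum 'I_n) sg al); apply => k; first by rewrite sg0 sgS.
  by rewrite mem_index_enum.
move: S S0 {sgS} => S S0; elim => [|i r IH] {sg0}sg {}al sgS sgr.
  under eq_integral do under eq_bigr do rewrite sgr//.
  under eq_bigr do rewrite sgr//.
  exact: joint_const.
pose sg' k := if k == i then S else sg k.
pose D := Num.sqrt (S - sg i).
pose al' u k := if k == i then al i + D * u else al k.
pose rest w := \prod_(k | k != i) gauss_tilt (sg k) (al k) (mx_coord k w).
have splitE u w : \prod_k gauss_tilt (sg' k) (al' u k) (mx_coord k w) =
    rest w * gauss_tilt S (al i + D * u) (mx_coord i w).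
  rewrite (bigD1 i)//= /sg' /al' eqxx mulrC; congr (_ * _).
  by apply: eq_bigr => k /negbTE ->.
have rest0 w : 0 <= rest w by apply: prodr_ge0 => k _; exact: gauss_tilt_ge0.
have mrest : measurable_fun setT rest.
  rewrite /rest; under eq_fun do rewrite big_mkcond/=.
  apply: measurable_prod => k _; case: (k != i) => //.
  apply: measurableT_comp; first exact: measurable_gauss_tilt.
  exact: measurable_mx_coord.
transitivity (\int[P]_w \int[normal_prob 0 1]_u
    (rest w * gauss_tilt S (al i + D * u) (mx_coord i w))%:E)%E.
  apply: eq_integral => w _.
  under eq_integral do rewrite EFinM.
  rewrite ge0_integralZl//=.
  - rewrite gauss_tilt_mixture ?(andP (sgS i)).2// -EFinM; congr EFin.
    by rewrite (bigD1 i)//= mulrC.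
  - apply/measurable_EFinP; apply: measurableT_comp => //.
    apply: measurable_funD => //; apply: measurable_funM => //.
    by apply: measurable_funD => //; exact: measurable_funM.
  - by move=> u _; rewrite lee_fin gauss_tilt_ge0.
  - by rewrite lee_fin.
rewrite (tonelli_curried P (normal_prob 0 1)
  (f := fun w u => rest w * gauss_tilt S (al i + D * u) (mx_coord i w))).
- under eq_integral => u _.
    under eq_integral do rewrite -splitE.
    rewrite IH; last 2 first.
      by move=> k; rewrite /sg'; case: ifP => // _; rewrite S0 lexx.
    move=> k kr; rewrite /sg'; case: eqP => // /eqP ki.
    by apply: sgr; rewrite inE negb_or ki.
    rewrite (bigD1 i)//= /sg' /al' eqxx mulrC.
    rewrite (_ : \prod_(k | k != i) _ =
      \prod_(k | k != i) gauss_tilt_mean (sg k) (al k)); last first.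
      by apply: eq_bigr => k /negbTE ->.
    rewrite EFinM; over.
  rewrite ge0_integralZl//=.
  + rewrite gauss_tilt_mean_mixture// -EFinM; congr EFin.
    by rewrite [RHS](bigD1 i)//= mulrC.
  + apply/measurable_EFinP; apply: measurable_funM => //.
    apply: measurableT_comp => //; apply: measurable_funM => //.
    by apply: measurable_funX; exact: measurable_funD.
  + by move=> u _; rewrite lee_fin gauss_tilt_mean_ge0.
  + by rewrite lee_fin prodr_ge0// => k _; exact: gauss_tilt_mean_ge0.
- apply: measurable_funM; first exact: measurableT_comp.
  by apply: measurable_gauss_tilt_pair; exact: measurable_mx_coord.
- by move=> w u; rewrite mulr_ge0// gauss_tilt_ge0.
Qed.

End orthogonal_transform.

(** * Markov inequality and the second moment method *)

Lemma expectation_const {R : realType} {d : measure_display}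
    {T : measurableType d} (P : probability T R) (c : R) :
  (\int[P]_w c%:E = c%:E)%E.
Proof.
by rewrite integral_cst//= -[RHS]mule1; congr (_ * _)%E; exact: probability_setT.
Qed.

Lemma markov_ge0 {R : realType} {d : measure_display} {T : measurableType d}
    (P : probability T R) (f : T -> R) (A : set T) (a b : R) :
  0 < a -> (forall w, 0 <= f w) -> measurable_fun setT f -> measurable A ->
  (forall w, A w -> a <= f w) ->
  (\int[P]_w (f w)%:E <= b%:E)%E -> (P A <= (b / a)%:E)%E.
Proof.
move=> a0 f0 mf mA Af fb.
have : (a%:E * P A <= b%:E)%E.
  apply: le_trans fb.
  rewrite -integral_cst//.
  apply: (@le_trans _ _ (\int[P]_(w in A) (f w)%:E)%E).
    apply: ge0_le_integral => //.
    - by move=> w _; rewrite lee_fin ltW.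
    - by apply/measurable_EFinP; exact: measurable_funTS.
  apply: ge0_subset_integral => //.
  - exact/measurable_EFinP.
  - by move=> w _; rewrite lee_fin.
rewrite -(@fineK _ (P A)) ?fin_num_measure// -EFinM !lee_fin.
by rewrite ler_pdivlMr// mulrC.
Qed.

(** Pairs that do not overlap are uncorrelated and the others contribute at most
    1 to the variance of the sum, which is thus at most #|I| * J; conclude by
    Chebyshev's inequality. *)
Lemma second_moment_lower_tail {R : realType} {d : measure_display}
    {T : measurableType d} (P : probability T R) (I : finType)
    (e : I -> T -> R) (m : I -> R) (ov : rel I) (J : nat) (mu : R) :
  (forall i w, 0 <= e i w <= 1) ->
  (forall i, measurable_fun setT (e i)) ->
  (forall i, \int[P]_w (e i w)%:E = (m i)%:E)%E ->
  (forall i j, ~~ ov i j -> \int[P]_w (e i w * e j w)%:E = (m i * m j)%:E)%E ->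
  (forall i, #|ov i| <= J)%N ->
  0 < mu -> mu <= \sum_i m i ->
  (P [set w | (\sum_i e i w <= mu / 2)%R] <=
    (4 * (#|I| * J)%:R / mu ^+ 2)%:E)%E.
Proof.
move=> e01 me Ee Eee ovJ mu0 muM.
have e0 i w : 0 <= e i w by case/andP: (e01 i w).
have e1 i w : e i w <= 1 by case/andP: (e01 i w).
pose Z w := \sum_i e i w.
pose M := \sum_i m i.
have M0 : 0 < M := lt_le_trans mu0 muM.
have m0 i : 0 <= m i.
  by rewrite -lee_fin -Ee; apply: integral_ge0 => w _; rewrite lee_fin.
have mZ : measurable_fun setT Z by exact: measurable_sum.
have Z0 w : 0 <= Z w by exact: sumr_ge0.
have EZ : (\int[P]_w (Z w)%:E = M%:E)%E.
  under eq_integral do rewrite -sumEFin.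
  rewrite ge0_integral_sum//.
  - by rewrite -sumEFin; apply: eq_bigr.
  - by move=> i; exact/measurable_EFinP.
  - by move=> i w _; rewrite lee_fin.
have mee i j : measurable_fun setT (fun w => e i w * e j w).
  exact: measurable_funM.
have Eee1 i j : (\int[P]_w (e i w * e j w)%:E <= (m i * m j + (ov i j)%:R)%:E)%E.
  have [oij|noij] := boolP (ov i j); last by rewrite addr0 Eee.
  apply: (@le_trans _ _ (\int[P]_w 1%:E)%E).
    apply: ge0_le_integral => //.
    - by move=> w _; rewrite lee_fin mulr_ge0.
    - exact/measurable_EFinP.
    - by move=> w _; rewrite lee_fin mulr_ile1.
  by rewrite expectation_const lee_fin lerDr mulr_ge0.
have EZ2 : (\int[P]_w (Z w ^+ 2)%:E <= (M ^+ 2 + (#|I| * J)%:R)%:E)%E.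
  under eq_integral => w _.
    rewrite expr2 /Z big_distrlr/= -sumEFin.
    under eq_bigr do rewrite -sumEFin.
    over.
  rewrite ge0_integral_sum//; last 2 first.
  - move=> i; rewrite (_ : (fun _ => _) = fun w => (\sum_j e i w * e j w)%:E).
      by apply/measurable_EFinP; exact: measurable_sum.
    by apply/funext => w; rewrite -sumEFin.
  - by move=> i w _; apply: sume_ge0 => j _; rewrite lee_fin mulr_ge0.
  apply: (@le_trans _ _ (\sum_i \sum_j (m i * m j + (ov i j)%:R)%:E)%E).
    apply: lee_sum => i _; rewrite ge0_integral_sum//.
    - by apply: lee_sum.
    - by move=> j; exact/measurable_EFinP.
    - by move=> j w _; rewrite lee_fin mulr_ge0.
  under eq_bigr do rewrite sumEFin.
  rewrite sumEFin lee_fin.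
  under eq_bigr do rewrite big_split/=.
  rewrite big_split/= expr2 [M * M]big_distrlr/= lerD2l.
  rewrite natrM -sum1_card natr_sum mulr_suml.
  apply: ler_sum => i _; rewrite mul1r -natr_sum ler_nat.
  apply: leq_trans (ovJ i).
  by rewrite -sum1_card [leqRHS]big_mkcond.
have EV : (\int[P]_w ((Z w - M) ^+ 2)%:E <= (#|I| * J)%:R%:E)%E.
  have mV : measurable_fun setT (fun w => (Z w - M) ^+ 2).
    by apply: measurable_funX; exact: measurable_funB.
  (* Written with sums only, so that all integrands are nonnegative. *)
  have : (\int[P]_w ((Z w - M) ^+ 2)%:E + (2 * M ^+ 2)%:E =
      \int[P]_w (Z w ^+ 2)%:E + (M ^+ 2)%:E)%E.
    have -> : ((2 * M ^+ 2)%:E = \int[P]_w (2 * M * Z w)%:E)%E.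
      under eq_integral do rewrite EFinM.
      rewrite ge0_integralZl//=.
      - by rewrite EZ -EFinM; congr EFin; ring.
      - exact/measurable_EFinP.
      - by move=> w _; rewrite lee_fin.
      - by rewrite lee_fin mulr_ge0 ?ltW.
    have -> : ((M ^+ 2)%:E = \int[P]_w (cst (M ^+ 2)%:E w))%E.
      by rewrite expectation_const.
    rewrite -!ge0_integralD//=.
    - by apply: eq_integral => w _; rewrite -!EFinD; congr EFin; ring.
    - by move=> w _; rewrite lee_fin sqr_ge0.
    - by apply/measurable_EFinP; exact: measurable_funX.
    - by move=> w _; rewrite lee_fin sqr_ge0.
    - by move=> w _; rewrite lee_fin sqr_ge0.
    - exact/measurable_EFinP.
    - by move=> w _; rewrite lee_fin mulr_ge0// mulr_ge0// ltW.
    - by apply/measurable_EFinP; exact: measurable_funM.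
  move=> eqV.
  have : (\int[P]_w ((Z w - M) ^+ 2)%:E + (2 * M ^+ 2)%:E <=
      (#|I| * J)%:R%:E + (2 * M ^+ 2)%:E)%E.
    rewrite eqV; apply: le_trans (leeD2r _ EZ2) _.
    by rewrite -!EFinD lee_fin; lra.
  by rewrite leeD2rE.
have -> : 4 * (#|I| * J)%:R / mu ^+ 2 = (#|I| * J)%:R / (mu ^+ 2 / 4) :> R.
  by field; rewrite gt_eqF.
apply: markov_ge0 EV.
- by rewrite divr_gt0// exprn_gt0.
- by move=> w; exact: sqr_ge0.
- by apply: measurable_funX; exact: measurable_funB.
- rewrite -[X in measurable X]setTI; apply: (@measurable_fun_le _ _ _ setT).
  + exact: measurableT.
  + exact: mZ.
  + exact: measurable_cst.
move=> w /= Zmu.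
have h : 0 <= M - mu / 2 - mu / 2 by rewrite /M; lra.
have h2 : 0 <= mu / 2 - Z w by rewrite subr_ge0.
have -> : (Z w - M) ^+ 2 = (M - Z w) ^+ 2 by ring.
have -> : mu ^+ 2 / 4 = (mu / 2) ^+ 2 by field.
by rewrite ler_pXn2r// ?nnegrE; lra.
Qed.

(** * Squared moduli and roots of unity *)

Section abs2.
Context {R : realType}.
Implicit Types z u : R[i].

(** The squared modulus with values in R, which avoids square roots and order
    comparisons in R[i]. *)
Definition abs2 z : R := complex.Re z ^+ 2 + complex.Im z ^+ 2.

Lemma abs2_ge0 z : 0 <= abs2 z. Proof. by rewrite addr_ge0 ?sqr_ge0. Qed.

Lemma abs2M z u : abs2 (z * u) = abs2 z * abs2 u.
Proof. by case: z => a b; case: u => c d; rewrite /abs2/=; ring. Qed.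

Lemma abs2_1 : abs2 1 = 1.
Proof. by rewrite /abs2/= expr0n/= expr1n addr0. Qed.

Lemma abs2X z m : abs2 (z ^+ m) = abs2 z ^+ m.
Proof. by elim: m => [|m IH]; rewrite ?expr0 ?abs2_1// !exprS abs2M IH. Qed.

Lemma abs2_conj z : real_complex R (abs2 z) = z * conjc z.
Proof. by rewrite /abs2 add_Re2_Im2 sqr_normc. Qed.

Lemma abs2_nat n : abs2 n%:R = n%:R ^+ 2.
Proof.
have -> : (n%:R : R[i]) = real_complex R n%:R by rewrite rmorph_nat.
by rewrite /abs2/= expr0n addr0.
Qed.

Lemma abs2_root1 z n : (0 < n)%N -> z ^+ n = 1 -> abs2 z = 1.
Proof.
move=> n0 zn; apply/eqP; rewrite -(@pexpr_eq1 _ _ n)// ?abs2_ge0//.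
by rewrite -abs2X zn abs2_1.
Qed.

Lemma conjc_root1 z n : (0 < n)%N -> z ^+ n = 1 -> conjc z = z^-1.
Proof.
move=> n0 zn; have z0 : z != 0.
  by apply: contra_eq_neq zn => ->; rewrite expr0n gtn_eqF// eq_sym oner_eq0.
apply: (mulfI z0); rewrite mulfV// -abs2_conj (abs2_root1 n0 zn).
by rewrite rmorph1.
Qed.

Lemma Re_sum (I : Type) (r : seq I) (p : pred I) (F : I -> R[i]) :
  complex.Re (\sum_(i <- r | p i) F i) = \sum_(i <- r | p i) complex.Re (F i).
Proof. by apply: (big_morph (@complex.Re R)) => // -[a b] [c d]. Qed.

Lemma Im_sum (I : Type) (r : seq I) (p : pred I) (F : I -> R[i]) :
  complex.Im (\sum_(i <- r | p i) F i) = \sum_(i <- r | p i) complex.Im (F i).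
Proof. by apply: (big_morph (@complex.Im R)) => // -[a b] [c d]. Qed.

Lemma abs2_sum_le (I : finType) (p : pred I) (F : I -> R[i]) :
  (forall i, abs2 (F i) <= 1) -> abs2 (\sum_(i | p i) F i) <= #|p|%:R ^+ 2.
Proof.
move=> F1; rewrite -lecR rmorphXn rmorph_nat /abs2 add_Re2_Im2.
rewrite ler_pXn2r ?nnegrE ?normr_ge0 ?ler0n//.
apply: le_trans (ler_norm_sum _ _ _) _.
rewrite -sum1_card natr_sum; apply: ler_sum => i _.
rewrite -(@ler_pXn2r _ 2)// ?nnegrE ?normr_ge0// expr1n.
by rewrite -add_Re2_Im2 -(rmorph1 (real_complex R)) lecR; exact: F1.
Qed.

Lemma complex_prim_root_exists n :
  (0 < n)%N -> exists z : R[i], n.-primitive_root z.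
Proof.
pose p : {poly R[i]} := 'X^n - 1; have [r Dp] := closed_field_poly_normal p.
move=> n0; rewrite (monicP _) ?monicXnsubC // scale1r in Dp.
have rn1 : all n.-unity_root r by apply/allP=> z; rewrite -root_prod_XsubC -Dp.
have szr : (n < (size r).+1)%N.
  by rewrite -(size_prod_XsubC r id) -Dp size_XnsubC.
have [|z] := hasP (cyclic.has_prim_root n0 rn1 _ szr); last by exists z.
by rewrite -separable.separable_prod_XsubC -Dp
  cyclotomic.separable_Xn_sub_1// pnatr_eq0 -lt0n.
Qed.

End abs2.

(** * Discrete Fourier and Hartley transforms *)

Section dft.
Context {R : realType} (N' : nat).
Let N := N'.+1.
Variable z : R[i].
Hypothesis zP : N.-primitive_root z.

(** The characters of the additive group Z/N carried by 'I_N. *)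
Definition chi (k j : 'I_N) : R[i] := z ^+ (k * j).

Lemma chiC k j : chi k j = chi j k.
Proof. by rewrite /chi mulnC. Qed.

Lemma chiDr k i j : chi k (i + j) = chi k i * chi k j.
Proof.
rewrite /chi -exprD -mulnDr -(prim_expr_mod zP) -[RHS](prim_expr_mod zP).
by rewrite /= modnMmr.
Qed.

Lemma chiDl k l j : chi (k + l) j = chi k j * chi l j.
Proof. by rewrite chiC chiDr !(chiC j). Qed.

Lemma chi0l j : chi 0 j = 1.
Proof. by rewrite /chi mul0n. Qed.

Lemma chi_root k j : chi k j ^+ N = 1.
Proof. by rewrite /chi exprAC (prim_expr_order zP) expr1n. Qed.

Lemma abs2_chi k j : abs2 (chi k j) = 1.
Proof. exact: (abs2_root1 (ltn0Sn _) (chi_root k j)). Qed.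

Lemma chiNl k j : chi (- k) j = conjc (chi k j).
Proof.
have chi_neq0 : chi k j != 0.
  apply/eqP => h; have /eqP := abs2_chi k j.
  by rewrite h /abs2/= !expr0n/= addr0 eq_sym oner_eq0.
rewrite (conjc_root1 (ltn0Sn _) (chi_root k j)).
by apply: (mulIf chi_neq0); rewrite -chiDl addNr chi0l mulVf.
Qed.

Lemma sum_chi k : \sum_j chi k j = if k == 0 then N%:R else 0.
Proof.
case: eqP => [->|/eqP k0].
  by under eq_bigr do rewrite chi0l; rewrite sumr_const card_ord.
have h : (z ^+ k - 1) * \sum_(j < N) (z ^+ k) ^+ j = 0.
  by rewrite -subrX1 exprAC (prim_expr_order zP) expr1n subrr.
have zk : z ^+ k - 1 != 0.
  rewrite subr_eq0 -(prim_order_dvd zP); apply: contra k0 => kN.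
  apply/eqP/val_inj => /=; apply/eqP; rewrite -leqn0 leqNgt; apply/negP => k0.
  by have := dvdn_leq k0 kN; rewrite leqNgt ltn_ord.
move/eqP: h; rewrite mulf_eq0 (negbTE zk)/= => /eqP h.
by rewrite -[RHS]h; apply: eq_bigr => j _; rewrite -exprM.
Qed.

Definition dft (f : 'I_N -> R[i]) (k : 'I_N) : R[i] := \sum_j f j * chi k j.

Lemma chiNr k j : chi k (- j) = conjc (chi k j).
Proof. by rewrite chiC chiNl chiC. Qed.

Lemma parseval (f : 'I_N -> R[i]) :
  \sum_k abs2 (dft f k) = N%:R * \sum_j abs2 (f j).
Proof.
apply: (@complexI R); rewrite rmorphM rmorph_nat !rmorph_sum/=.
transitivity (\sum_i \sum_j \sum_k f i * conjc (f j) * chi (i - j) k).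
  rewrite (eq_bigr (fun k => \sum_i \sum_j f i * conjc (f j) * chi (i - j) k)).
    by rewrite exchange_big/=; apply: eq_bigr => i _; rewrite exchange_big.
  move=> k _; rewrite abs2_conj /dft rmorph_sum big_distrlr/=.
  apply: eq_bigr => i _; apply: eq_bigr => j _.
  by rewrite rmorphM/= -chiNr [chi (i - j) k]chiC chiDr; ring.
rewrite mulr_sumr; apply: eq_bigr => i _; rewrite (bigD1 i)//= [X in _ + X]big1 ?addr0.
  by rewrite -mulr_sumr sum_chi subrr eqxx abs2_conj mulrC.
move=> j ji; rewrite -mulr_sumr sum_chi subr_eq0 eq_sym (negbTE ji).
by rewrite mulr0.
Qed.

Lemma dft_convolution (f g : 'I_N -> R[i]) k :
  dft (fun j => \sum_i f i * g (j - i)) k = dft f k * dft g k.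
Proof.
rewrite /dft; under eq_bigr do rewrite mulr_suml.
rewrite exchange_big mulr_suml/=; apply: eq_bigr => i _.
rewrite (reindex_inj (addIr i))/= mulr_sumr; apply: eq_bigr => j _.
by rewrite addrK chiDr; ring.
Qed.

(** The rows cos + sin form a real orthonormal basis in which all frequencies
    play the same role, whereas with separate cosines and sines the frequencies
    0 and N/2 are exceptional. *)
Definition hartley_mx : 'M[R]_N :=
  \matrix_(k, j) ((complex.Re (chi k j) + complex.Im (chi k j)) / Num.sqrt N%:R).

(** (Re a + Im a)(Re b + Im b) = Re (a conj b) + Im (a b), and the character sums
    of chi_k conj(chi_l) and of chi_k chi_l are N or 0, hence real. *)
Lemma hartley_mx_orthogonal : hartley_mx *m hartley_mx^T = 1%:M.
Proof.
apply/matrixP => k l; rewrite !mxE.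
have N0 : (N%:R : R) != 0 by rewrite pnatr_eq0.
have sN : Num.sqrt N%:R ^+ 2 = N%:R :> R by rewrite sqr_sqrtr.
have sN0 : Num.sqrt N%:R != 0 :> R.
  by rewrite -sqrf_eq0 sN.
transitivity (N%:R^-1 * (complex.Re (\sum_j chi k j * conjc (chi l j)) +
    complex.Im (\sum_j chi k j * chi l j))).
  rewrite Re_sum Im_sum -big_split mulr_sumr; apply: eq_bigr => j _.
  rewrite !mxE; case: (chi k j) => a b; case: (chi l j) => c e /=.
  by move: (Num.sqrt _) sN sN0 => q <- q0; field.
under eq_bigr do rewrite -chiNl -chiDl.
under [X in complex.Im X]eq_bigr do rewrite -chiDl.
rewrite !sum_chi subr_eq0.
have ImN (b : bool) : complex.Im (if b then N%:R else 0 : R[i]) = 0.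
  by case: b => //; have -> : (N%:R : R[i]) = real_complex R N%:R by rewrite rmorph_nat.
rewrite ImN addr0; case: eqP => _ /=; last by rewrite mulr0.
have -> : (N%:R : R[i]) = real_complex R N%:R by rewrite rmorph_nat.
by rewrite /= mulVf.
Qed.

(** For real y, the Hartley coefficients at k and - k are, up to normalization,
    the sum and the difference of the real and imaginary parts of the Fourier
    coefficient at k. *)
Lemma abs2_dft_real (y : 'I_N -> R) k :
  abs2 (dft (fun j => real_complex R (y j)) k) =
  N%:R / 2 * ((\sum_j hartley_mx k j * y j) ^+ 2 +
              (\sum_j hartley_mx (- k) j * y j) ^+ 2).
Proof.
have sN : Num.sqrt N%:R ^+ 2 = N%:R :> R by rewrite sqr_sqrtr.
have sN0 : Num.sqrt N%:R != 0 :> R.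
  by rewrite -sqrf_eq0 sN pnatr_eq0.
pose u := \sum_j y j * complex.Re (chi k j).
pose v := \sum_j y j * complex.Im (chi k j).
have -> : \sum_j hartley_mx k j * y j = (u + v) / Num.sqrt N%:R.
  rewrite -big_split mulr_suml; apply: eq_bigr => j _; rewrite !mxE/=; ring.
have -> : \sum_j hartley_mx (- k) j * y j = (u - v) / Num.sqrt N%:R.
  rewrite -sumrB mulr_suml; apply: eq_bigr => j _; rewrite !mxE chiNl.
  by case: (chi k j) => a b /=; ring.
have -> : abs2 (dft (fun j => real_complex R (y j)) k) = u ^+ 2 + v ^+ 2.
  rewrite /abs2 /dft Re_sum Im_sum; congr (_ ^+ 2 + _ ^+ 2);
    apply: eq_bigr => j _; case: (chi k j) => a b /=; ring.
by move: (Num.sqrt _) sN sN0 => q <- q0; field.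
Qed.

End dft.

(** * Test vectors concentrated in frequency *)

Section window.
Context {R : realType} (N' l : nat).
Let N := N'.+1.
Variable z : R[i].
Hypothesis zP : N.-primitive_root z.
Hypothesis l0 : (0 < l)%N.
Hypothesis lN : (l <= N)%N.

Let lR0 : 0 < l%:R :> R. Proof. by rewrite ltr0n. Qed.

Definition box_poly : {poly R[i]} := \poly_(i < l) 1.

(** The Dirichlet kernel of length l. *)
Definition box_dft (k : 'I_N) : R[i] := box_poly.[z ^+ k].

Lemma dft_coef (f : {poly R[i]}) (k : 'I_N) : (size f <= N)%N ->
  dft z (fun j : 'I_N => f`_j) k = f.[z ^+ k].
Proof.
move=> sf; rewrite (horner_coef_wide _ sf); apply: eq_bigr => j _.
by rewrite /chi exprM.
Qed.

Lemma box_dft_le k : abs2 (box_dft k) <= l%:R ^+ 2.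
Proof.
rewrite /box_dft horner_poly.
have := @abs2_sum_le R 'I_l xpredT (fun i => 1 * (z ^+ k) ^+ i).
rewrite card_ord; apply => i; rewrite mul1r -exprM.
rewrite (@abs2_root1 _ _ N)//.
by rewrite exprAC (prim_expr_order zP) expr1n.
Qed.

Lemma box_dft0 : box_dft 0 = l%:R.
Proof.
rewrite /box_dft expr0 horner_poly.
under eq_bigr do rewrite expr1n mulr1.
by rewrite sumr_const card_ord.
Qed.

Lemma box_energy : \sum_k abs2 (box_dft k) = N%:R * l%:R.
Proof.
have sb : (size box_poly <= N)%N := leq_trans (size_poly _ _) lN.
under eq_bigr do rewrite /box_dft -dft_coef//.
rewrite (parseval zP); congr (_ * _).
rewrite (eq_bigr (fun j : 'I_N => if (j < l)%N then 1 else 0)); last first.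
  move=> j _; rewrite coef_poly; case: ifP => _; first exact: abs2_1.
  by rewrite /abs2/= !expr0n addr0.
by rewrite -big_mkcond/= (big_ord_narrow lN) sumr_const card_ord.
Qed.

(** Defined by a threshold and not as an interval around 0: only its cardinality
    is needed, and Parseval's identity bounds it without any estimate on sines. *)
Definition main_lobe : {set 'I_N} :=
  [set k : 'I_N | l%:R ^+ 2 / 4 < abs2 (box_dft k)]%SET.

Lemma card_main_lobe : (#|main_lobe|%:R : R) <= 4 * N%:R / l%:R.
Proof.
rewrite ler_pdivlMr//.
have : #|main_lobe|%:R * (l%:R ^+ 2 / 4) <= N%:R * l%:R :> R.
  rewrite -box_energy mulr_natl -sumr_const.
  rewrite [leRHS](bigID (mem main_lobe))/=.
  apply: ler_wpDr; first by apply: sumr_ge0 => k _; exact: abs2_ge0.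
  by apply: ler_sum => k; rewrite inE => /ltW.
by move=> h; rewrite -(ler_pM2r lR0); lra.
Qed.

(** Symmetric under k -> - k because the Fourier coefficient at k involves the
    Hartley coefficients at both k and - k. *)
Definition window (k0 : 'I_N) : {set 'I_N} :=
  [set k : 'I_N | (k - k0 \in main_lobe) || (- k - k0 \in main_lobe)]%SET.

Lemma windowN k0 k : (- k \in window k0) = (k \in window k0).
Proof. by rewrite !inE opprK orbC. Qed.

Lemma card_translates (k : 'I_N) (s : bool) (A : {set 'I_N}) :
  (#|[set i : 'I_N | (if s then k - i else i - k)%R \in A]%SET| <= #|A|)%N.
Proof.
rewrite -(card_imset (mem A) (f := fun a => if s then k - a else a + k)).
  apply: subset_leq_card; apply/fintype.subsetP => i; rewrite inE => iA.
  apply/imsetP; exists (if s then k - i else i - k) => //.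
  by case: s {iA}; rewrite ?subKr ?subrK.
by case: s => a b /=; [move/(addrI k)/oppr_inj|move/addIr].
Qed.

Lemma card_window k0 : (#|window k0| <= 2 * #|main_lobe|)%N.
Proof.
have -> : window k0 = ([set k : 'I_N | k - k0 \in main_lobe] :|:
    [set k : 'I_N | - k0 - k \in main_lobe])%SET.
  by apply/setP => k; rewrite !inE [- k0 - k]addrC.
apply: leq_trans (leq_card_setU _ _) _; rewrite mul2n -addnn leq_add//.
  exact: (card_translates k0 false).
exact: (card_translates (- k0) true).
Qed.

Definition overlap (k0 k1 : 'I_N) : bool :=
  [exists k, (k \in window k0) && (k \in window k1)].

(** If k lies in the windows of k0 and of k1, then k1 is k or - k minus an element
    of the main lobe. *)
Lemma card_overlap k0 : (#|overlap k0| <= (2 * #|main_lobe|) ^ 2)%N.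
Proof.
pose S k := ([set i : 'I_N | k - i \in main_lobe] :|:
             [set i : 'I_N | - k - i \in main_lobe])%SET.
have cS k : (#|S k| <= 2 * #|main_lobe|)%N.
  apply: leq_trans (leq_card_setU _ _) _; rewrite mul2n -addnn leq_add//.
    exact: (card_translates k true).
  exact: (card_translates (- k) true).
apply: (@leq_trans #|(\bigcup_(k in window k0) S k)%SET|).
  apply: subset_leq_card; apply/fintype.subsetP => k1.
  rewrite unfold_in /overlap => /existsP[k /andP[kW kW1]].
  by apply/bigcupP; exists k => //; move: kW1; rewrite !inE.
apply: (@leq_trans (\sum_(k in window k0) #|S k|)%N).
  elim/big_ind2: _ => // [|A a B b Aa Bb]; first by rewrite cards0.
  by apply: leq_trans (leq_card_setU _ _) _; exact: leq_add.
apply: leq_trans (leq_sum _ (fun k _ => cS k)) _.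
by rewrite sum_nat_const -mulnn leq_mul2r card_window orbT.
Qed.

Section eigenvalue_bound.
Variables (p m : nat) (y : 'I_N -> R) (lam tau : R) (k0 : 'I_N).
Hypothesis pN : (p <= N)%N.
Hypothesis mp : (m.+1 * l.-1 < p)%N.
Hypothesis lam0 : 0 <= lam.
Hypothesis lamP : forall v : 'I_N -> R,
  (forall i : 'I_N, (p <= i)%N -> v i = 0) ->
  lam * \sum_i v i ^+ 2 <= \sum_j (\sum_i v i * y (j - i)) ^+ 2.

Definition hartley (k : 'I_N) : R := \sum_j hartley_mx N' z k j * y j.

Hypothesis tauP : forall k, hartley k ^+ 2 <= tau.

Let h : {poly R[i]} := box_poly ^+ m.+1.
Let V (j : 'I_N) : R[i] := h`_j * conjc (chi z k0 j).

Let size_h : (size h <= p)%N.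
Proof.
apply: leq_trans (size_poly_exp_leq _ _) _.
apply: leq_trans mp; rewrite ltnS mulnC leq_mul2l/=.
by rewrite -!subn1 leq_sub2r// size_poly.
Qed.

Let dftV k : dft z V k = box_dft (k - k0) ^+ m.+1.
Proof.
rewrite /box_dft -horner_exp -/h -dft_coef; last exact: leq_trans size_h pN.
by apply: eq_bigr => j _; rewrite /V (chiDl zP) (chiNl zP); ring.
Qed.

(** The hypothesis on lam is about real vectors; add it for the real and the
    imaginary parts. *)
Let energy_le (f : 'I_N -> R[i]) : (forall i : 'I_N, (p <= i)%N -> f i = 0) ->
  lam * \sum_i abs2 (f i) <=
  \sum_j abs2 (\sum_i f i * real_complex R (y (j - i))).
Proof.
move=> f0; rewrite big_split/= mulrDr.
have [/= re im] := (lamP (v := fun i => complex.Re (f i)),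
               lamP (v := fun i => complex.Im (f i))).
apply: le_trans (lerD (re _) (im _)) _; try by move=> i /f0 ->.
rewrite -big_split/=; apply: ler_sum => j _.
rewrite /abs2 Re_sum Im_sum le_eqVlt; apply/orP; left; apply/eqP.
congr (_ ^+ 2 + _ ^+ 2); apply: eq_bigr => i _;
  by case: (f i) => a b /=; ring.
Qed.

(** The squared Fourier transform of V, normalized to be 1 at its peak and
    translated to peak at 0. *)
Let weight (k : 'I_N) : R := (abs2 (box_dft k) / l%:R ^+ 2) ^+ m.+1.

Let weight_ge0 k : 0 <= weight k.
Proof. by rewrite exprn_ge0// divr_ge0 ?abs2_ge0 ?sqr_ge0. Qed.

Let weight_le1 k : weight k <= 1.
Proof.
rewrite exprn_ile1// ?divr_ge0 ?abs2_ge0 ?sqr_ge0//.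
by rewrite ler_pdivrMr ?exprn_gt0// mul1r box_dft_le.
Qed.

Let weight_side k : k \notin main_lobe ->
  weight k <= 4^-1 ^+ m * (abs2 (box_dft k) / l%:R ^+ 2).
Proof.
rewrite inE -leNgt => kD; rewrite /weight exprSr.
apply: ler_wpM2r; first by rewrite divr_ge0 ?abs2_ge0 ?sqr_ge0.
apply: lerXn2r; rewrite ?nnegrE ?divr_ge0 ?abs2_ge0 ?sqr_ge0 ?invr_ge0//.
by rewrite ler_pdivrMr ?exprn_gt0// mulrC.
Qed.

(** Test the quadratic form on V.  On the main lobe the weights are at most 1 and
    only the Hartley coefficients of the window contribute; off it one factor of
    the kernel is kept, to be summed by Parseval, and the others give 4^-m. *)
Lemma lam_le_window :
  lam <= N%:R * (\sum_(k in window k0) hartley k ^+ 2 +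
                 4^-1 ^+ m * (N%:R / l%:R) * tau).
Proof.
have NR0 : 0 < N%:R :> R by rewrite ltr0n.
have tau0 : 0 <= tau by apply: le_trans (tauP 0); exact: sqr_ge0.
pose L : R := (l%:R ^+ 2) ^+ m.+1.
have L0 : 0 < L by rewrite !exprn_gt0.
have absV k : abs2 (dft z V k) = L * weight (k - k0).
  rewrite dftV abs2X /weight /L -exprMn mulrCA mulfV ?mulr1//.
  by rewrite expf_neq0// gt_eqF.
have V0 (i : 'I_N) : (p <= i)%N -> V i = 0.
  by move=> pi; rewrite /V nth_default ?mul0r// (leq_trans size_h).
have normV : L <= N%:R * \sum_j abs2 (V j).
  rewrite -(parseval zP) (bigD1 k0)//= absV subrr.
  have -> : weight 0 = 1.
    by rewrite /weight box_dft0 abs2_nat mulfV ?expr1n// expf_neq0// gt_eqF.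
  by rewrite mulr1 lerDl sumr_ge0// => k _; exact: abs2_ge0.
have energyV : \sum_j abs2 (\sum_i V i * real_complex R (y (j - i))) =
    L * \sum_k weight (k - k0) * ((hartley k ^+ 2 + hartley (- k) ^+ 2) / 2).
  apply: (mulfI (x := N%:R)); first by rewrite gt_eqF.
  rewrite -(parseval zP) !mulr_sumr; apply: eq_bigr => k _.
  rewrite (dft_convolution zP V (fun j => real_complex R (y j))).
  rewrite abs2M absV (abs2_dft_real zP) -/(hartley k) -/(hartley (- k)) -/N.
  by field.
have split_sum : \sum_k weight (k - k0) *
      ((hartley k ^+ 2 + hartley (- k) ^+ 2) / 2) <=
    \sum_(k in window k0) hartley k ^+ 2 + 4^-1 ^+ m * (N%:R / l%:R) * tau.
  have H0 k : 0 <= (hartley k ^+ 2 + hartley (- k) ^+ 2) / 2.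
    by rewrite divr_ge0// addr_ge0 ?sqr_ge0.
  (* k -> - k preserves the window, so the average over k and - k drops out. *)
  rewrite (bigID (mem (window k0)))/=; apply: lerD.
    have -> : \sum_(k in window k0) hartley k ^+ 2 =
        \sum_(k in window k0) ((hartley k ^+ 2 + hartley (- k) ^+ 2) / 2).
      rewrite -mulr_suml big_split/= [X in _ + X](reindex_inj oppr_inj)/=.
      under [X in _ + X]eq_big => [k|k _]; first (rewrite windowN; over).
        rewrite opprK; over.
      by field.
    by apply: ler_sum => k _; rewrite ler_piMl.
  rewrite (_ : 4^-1 ^+ m * (N%:R / l%:R) * tau =
    \sum_k 4^-1 ^+ m * (abs2 (box_dft (k - k0)) / l%:R ^+ 2) * tau); last first.
    rewrite -mulr_suml -mulr_sumr -mulr_suml.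
    have -> : \sum_k abs2 (box_dft (k - k0)) = N%:R * l%:R.
      by rewrite -box_energy [RHS](reindex_inj (addIr (- k0))).
    by congr (_ * _ * _); field; exact: lt0r_neq0.
  rewrite [leRHS](bigID (mem (window k0)))/=; apply: ler_wpDl.
    apply: sumr_ge0 => k _; rewrite !mulr_ge0 ?exprn_ge0 ?invr_ge0//.
    exact: abs2_ge0.
  apply: ler_sum => k; rewrite inE negb_or => /andP[kD _].
  apply: ler_pM => //; first exact: weight_side.
  by have := tauP k; have := tauP (- k); lra.
have VE := energy_le V0.
have : lam * (L / N%:R) <= L * (\sum_(k in window k0) hartley k ^+ 2 +
                 4^-1 ^+ m * (N%:R / l%:R) * tau).
  apply: le_trans (_ : lam * \sum_j abs2 (V j) <= _).
    by rewrite ler_wpM2l// ler_pdivrMr// mulrC.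
  by apply: le_trans VE _; rewrite energyV ler_wpM2l// ltW.
by rewrite mulrCA ler_pM2l// ler_pdivrMr// [X in _ <= X -> _]mulrC.
Qed.

End eigenvalue_bound.

End window.

(** * Laplace functionals of sums of squared coordinates *)

Section chi_square.
Context {R : realType} {d : measure_display} {T : measurableType d}.
Context (P : probability T R) (n : nat) (x : 'I_n -> {RV P >-> R}).
Hypothesis iid : iid_std_normal x.
Variable O : 'M[R]_n.
Hypothesis OO : O *m O^T = 1%:M.
Let H := mx_coord x O.

Lemma gauss_tilt_mean00 : gauss_tilt_mean 0 0 = 1 :> R.
Proof. by rewrite /gauss_tilt_mean addr0 sqrtr1 invr1 expr0n/= mul0r expR0 mulr1. Qed.

Definition chi2_tilt (s : R) (S : {set 'I_n}) (w : T) : R :=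
  expR (- (s / 2) * \sum_(k in S) H k w ^+ 2).

Lemma measurable_chi2_tilt s S : measurable_fun setT (chi2_tilt s S).
Proof.
apply: measurableT_comp => //; apply: measurable_funM => //.
under eq_fun do rewrite big_mkcond/=.
apply: measurable_sum => k; case: (k \in S) => //.
by apply: measurable_funX; exact: measurable_mx_coord.
Qed.

Lemma chi2_tilt_itv s S w : 0 <= s -> 0 <= chi2_tilt s S w <= 1.
Proof.
move=> s0; rewrite expR_ge0/= -[leRHS]expR0 ler_expR mulNr oppr_le0.
by rewrite mulr_ge0 ?divr_ge0// sumr_ge0// => k _; exact: sqr_ge0.
Qed.

Lemma expectation_chi2_tilt s (S : {set 'I_n}) : 0 <= s ->
  (\int[P]_w (chi2_tilt s S w)%:E = ((Num.sqrt (1 + s))^-1 ^+ #|S|)%:E)%E.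
Proof.
move=> s0; pose sg k := if k \in S then s else 0.
transitivity (\int[P]_w (\prod_k gauss_tilt (sg k) 0 (H k w))%:E)%E.
  apply: eq_integral => w _; congr EFin.
  rewrite /chi2_tilt mulr_sumr expR_sum big_mkcond; apply: eq_bigr => k _.
  rewrite /sg /gauss_tilt mul0r addr0; case: ifP => _ //.
  by rewrite mul0r oppr0 mul0r expR0.
rewrite expectation_gauss_tilt//; last by move=> k; rewrite /sg; case: ifP.
congr EFin; rewrite -prodr_const [RHS]big_mkcond; apply: eq_bigr => k _.
rewrite /sg; case: ifP => _; last exact: gauss_tilt_mean00.
by rewrite /gauss_tilt_mean expr0n/= mul0r expR0 mulr1.
Qed.

Lemma expectation_chi2_tilt2 s (S1 S2 : {set 'I_n}) : 0 <= s ->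
  ~~ [exists k, (k \in S1) && (k \in S2)] ->
  (\int[P]_w (chi2_tilt s S1 w * chi2_tilt s S2 w)%:E =
   ((Num.sqrt (1 + s))^-1 ^+ #|S1| * (Num.sqrt (1 + s))^-1 ^+ #|S2|)%:E)%E.
Proof.
move=> s0 dis.
have dis' : (S1 :&: S2 = finset.set0)%SET.
  apply/setP => k; rewrite !inE; apply: contraNF dis => kk.
  by apply/existsP; exists k.
have -> : (fun w => (chi2_tilt s S1 w * chi2_tilt s S2 w)%:E) =
          (fun w => (chi2_tilt s (S1 :|: S2)%SET w)%:E).
  apply/funext => w; rewrite /chi2_tilt -expRD -mulrDr; congr (expR (_ * _))%:E.
  rewrite [RHS]big_mkcond [X in X + _]big_mkcond [X in _ + X]big_mkcond.
  rewrite -big_split; apply: eq_bigr => k _ /=; move/setP: dis' => /(_ k).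
  by rewrite !inE; case: (k \in S1); case: (k \in S2); rewrite ?addr0 ?add0r.
by rewrite expectation_chi2_tilt// cardsU dis' cards0 subn0 exprD.
Qed.

Lemma expectation_expR_coord k (b : R) :
  (\int[P]_w (expR (b * H k w))%:E = (expR (b ^+ 2 / 2))%:E)%E.
Proof.
pose al i := if i == k then b else 0.
transitivity (\int[P]_w (\prod_i gauss_tilt 0 (al i) (H i w))%:E)%E.
  apply: eq_integral => w _; congr EFin.
  rewrite (bigD1 k)//= big1 ?mulr1 /al /gauss_tilt.
    by rewrite eqxx mul0r oppr0 mul0r add0r.
  by move=> i /negbTE ->; rewrite !(mul0r, oppr0) add0r expR0.
rewrite expectation_gauss_tilt//; congr EFin.
rewrite (bigD1 k)//= big1 ?mulr1 /al.
  by rewrite eqxx /gauss_tilt_mean addr0 sqrtr1 invr1 mul1r mulr1.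
by move=> i /negbTE ->; exact: gauss_tilt_mean00.
Qed.

End chi_square.

(** * A random circulant matrix of fixed size *)

Lemma sqr_le_of_expR_sum {R : realType} (h t : R) :
  expR h + expR (- h) <= expR t -> h ^+ 2 <= t ^+ 2.
Proof.
move=> ht; have h1 : h <= t.
  by rewrite -ler_expR; apply: le_trans ht; rewrite lerDl expR_ge0.
have h2 : - h <= t.
  by rewrite -ler_expR; apply: le_trans ht; rewrite lerDr expR_ge0.
have t0 : 0 <= t by lra.
by rewrite -real_normK ?num_real// ler_pXn2r ?nnegrE// ler_norml; lra.
Qed.

(** Outside A1 the sum over k0 of exp(- s Q_k0 / 2) exceeds half of
    N (1 + s)^(- r / 2), a lower bound of its mean, so some term is at least
    (1 + s)^(- r / 2) / 2 and its window has a small Q_k0.  Outside A2 all Hartley coefficients are at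
    most 2 ln N in absolute value. *)
Lemma circulant_small_ball {R : realType} {d : measure_display}
    {T : measurableType d} (P : probability T R) (N' : nat)
    (y : 'I_N'.+1 -> {RV P >-> R}) (l p m : nat) (s rho : R) :
  let N := N'.+1 in
  iid_std_normal y ->
  (0 < l)%N -> (l <= N)%N -> (p <= N)%N -> (m.+1 * l.-1 < p)%N -> 0 < s ->
  8 * N%:R / l%:R <= rho ->
  exists A : set T, [/\ measurable A,
    (P A <= (4 * rho ^+ 2 * expR (rho * ln (1 + s)) / N%:R +
             2 * expR (1 / 2) / N%:R)%:E)%E &
    forall w lam, ~ A w -> 0 <= lam ->
      (forall v : 'I_N -> R, (forall i : 'I_N, (p <= i)%N -> v i = 0) ->
        lam * \sum_i v i ^+ 2 <=
        \sum_j (\sum_i v i * y (j - i)%R w) ^+ 2) ->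
      lam <= N%:R * ((2 * ln 2 + rho * ln (1 + s)) / s +
        4^-1 ^+ m * (N%:R / l%:R) * (2 * ln N%:R) ^+ 2)].
Proof.
move=> N iid l0 lN pN mp s0 hrho.
have [z zP] := @complex_prim_root_exists R N isT.
have OO := hartley_mx_orthogonal zP.
pose H := mx_coord y (hartley_mx N' z).
pose W := @window R N' l z.
pose r := (2 * #|main_lobe N' l z|)%N.
have NR0 : 0 < N%:R :> R by rewrite ltr0n.
have rrho : r%:R <= rho.
  apply: le_trans hrho; rewrite natrM.
  have := card_main_lobe zP l0 lN; rewrite -/N; lra.
have rho0 : 0 <= rho by apply: le_trans rrho; rewrite ler0n.
have ls0 : 0 < 1 + s by lra.
have lns : 0 <= ln (1 + s) by rewrite ln_ge0//; lra.
pose q : R := (Num.sqrt (1 + s))^-1.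
have sq0 : 0 < Num.sqrt (1 + s) by rewrite sqrtr_gt0.
have q0 : 0 < q by rewrite invr_gt0.
have q1 : q <= 1.
  by rewrite invf_le1// -(ler_pXn2r (n := 2)) ?nnegrE// ?expr1n ?sqr_sqrtr//; lra.
have qE : q ^+ 2 = expR (- ln (1 + s)).
  by rewrite exprVn sqr_sqrtr ?ltW// expRN lnK.
pose e k0 := chi2_tilt y (hartley_mx N' z) s (W k0).
pose mu : R := N%:R * q ^+ r.
have mu0 : 0 < mu by rewrite mulr_gt0// exprn_gt0.
pose A1 := [set w | (\sum_k0 e k0 w <= mu / 2)%R].
have PA1 : (P A1 <= (4 * rho ^+ 2 * expR (rho * ln (1 + s)) / N%:R)%:E)%E.
  apply: (@le_trans _ _ (4 * (#|'I_N| * r ^ 2)%:R / mu ^+ 2)%:E).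
    apply: (@second_moment_lower_tail _ _ _ _ _ e
        (fun k0 => q ^+ #|W k0|) (@overlap R N' l z)) => //.
    - by move=> i w; apply: chi2_tilt_itv; exact: ltW.
    - by move=> i; exact: measurable_chi2_tilt.
    - by move=> i; apply: (expectation_chi2_tilt iid OO); exact: ltW.
    - by move=> i j ij; apply: (expectation_chi2_tilt2 iid OO) => //; exact: ltW.
    - by move=> i; exact: card_overlap.
    - rewrite /mu mulr_natl -[X in _ *+ X](card_ord N) -sumr_const.
      apply: ler_sum => i _; apply: ler_wiXn2l => //; first exact: ltW.
      exact: card_window.
  rewrite lee_fin card_ord /mu natrM natrX exprMn.
  have -> : 4 * (N%:R * r%:R ^+ 2) / (N%:R ^+ 2 * (q ^+ r) ^+ 2) =
      4 * r%:R ^+ 2 * expR (r%:R * ln (1 + s)) / N%:R :> R.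
    have -> : expR (r%:R * ln (1 + s)) = (q ^+ r) ^- 2 :> R.
      by rewrite exprAC qE -expRM_natl mulrN expRN invrK.
    have qr0 : q ^+ r != 0 by rewrite gt_eqF// exprn_gt0.
    have N0 : N%:R != 0 :> R by rewrite gt_eqF.
    move: (q ^+ r) (N%:R : R) (r%:R : R) qr0 N0 => a b c a0 b0.
    by field; rewrite a0 b0.
  rewrite ler_pM2r ?invr_gt0//; apply: ler_pM.
  - by rewrite mulr_ge0 ?sqr_ge0.
  - exact: expR_ge0.
  - by rewrite ler_pM2l// ler_pXn2r ?nnegrE.
  - by rewrite ler_expR ler_wpM2r.
pose B w := \sum_k (expR (1 * H k w) + expR (-1 * H k w)).
pose A2 := [set w | (N%:R ^+ 2 <= B w)%R].
have mH k : measurable_fun setT (H k) by exact: measurable_mx_coord.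
have mE b k : measurable_fun setT (fun w => expR (b * H k w)).
  by apply: measurableT_comp => //; exact: measurable_funM.
have mB : measurable_fun setT B.
  by apply: measurable_sum => k; exact: measurable_funD.
have mZ : measurable_fun setT (fun w => \sum_k0 e k0 w).
  by apply: measurable_sum => k; exact: measurable_chi2_tilt.
have mA1 : measurable A1.
  rewrite -[X in measurable X]setTI; apply: (@measurable_fun_le _ _ _ setT).
  - exact: measurableT.
  - exact: mZ.
  - exact: measurable_cst.
have mA2 : measurable A2.
  rewrite -[X in measurable X]setTI; apply: (@measurable_fun_le _ _ _ setT).
  - exact: measurableT.
  - exact: measurable_cst.
  - exact: mB.
have PA2 : (P A2 <= (2 * expR (1 / 2) / N%:R)%:E)%E.
  have -> : 2 * expR (1 / 2) / N%:R =
      (N%:R * (2 * expR (1 / 2))) / N%:R ^+ 2 :> R.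
    move: (N%:R : R) (expR _) NR0 => a b a0.
    by field; rewrite gt_eqF.
  apply: (@markov_ge0 _ _ _ _ B) => //.
  - by rewrite exprn_gt0.
  - by move=> w; apply: sumr_ge0 => k _; rewrite addr_ge0 ?expR_ge0.
  under eq_integral do rewrite /B -sumEFin.
  rewrite ge0_integral_sum//; last first.
    by move=> k; apply/measurable_EFinP; exact: measurable_funD.
  have -> : (N%:R * (2 * expR (1 / 2)) : R) = \sum_(k < N) 2 * expR (1 / 2).
    by rewrite sumr_const card_ord mulr_natl.
  rewrite -sumEFin; apply: lee_sum => k _.
  under eq_integral do rewrite EFinD.
  rewrite ge0_integralD//.
  - rewrite !(expectation_expR_coord iid OO) sqrrN expr1n -EFinD lee_fin; lra.
  - by apply/measurable_EFinP.
  - by apply/measurable_EFinP.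
exists (A1 `|` A2); split; first exact: measurableU.
  by rewrite EFinD; apply: le_trans (measureU2 _ mA1 mA2) _ => //; exact: leeD.
move=> w lam /not_orP[/negP nA1 /negP nA2] lam0 lamP.
have {nA1} : mu / 2 < \sum_k0 e k0 w by rewrite ltNge.
have {nA2} BN : B w < N%:R ^+ 2 by rewrite ltNge.
have H2 k : H k w ^+ 2 <= (2 * ln N%:R) ^+ 2.
  apply: sqr_le_of_expR_sum.
  rewrite [expR (2 * _)]expRM_natl lnK//; apply: le_trans (ltW BN).
  by rewrite /B (bigD1 k)//= mul1r mulN1r lerDl sumr_ge0// => i _.
move=> Zmu.
have [k0 ek0] : exists k0, q ^+ r / 2 <= e k0 w.
  apply/not_existsP => h; move: Zmu; apply/negP; rewrite -leNgt.
  have -> : mu / 2 = \sum_(k < N) (q ^+ r / 2).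
    by rewrite sumr_const card_ord /mu -[RHS]mulr_natl mulrA.
  by apply: ler_sum => k _; rewrite leNgt; apply/negP => hk; apply: (h k); exact: ltW.
have lamW := @lam_le_window R N' l z zP l0 lN p m (fun j => y j w) lam
  ((2 * ln N%:R) ^+ 2) k0 pN mp lam0 lamP H2.
apply: le_trans lamW _; rewrite ler_pM2l// lerD2r.
rewrite ler_pdivlMr// mulrC.
have : expR (- ln 2 - r%:R / 2 * ln (1 + s)) <= e k0 w.
  apply: le_trans ek0; rewrite le_eqVlt; apply/orP; left; apply/eqP.
  have qE1 : q = expR (- (ln (1 + s) / 2)).
    apply: (@pexpIrn _ 2) => //; rewrite ?nnegrE ?expR_ge0 ?ltW//.
    by rewrite qE -expRM_natl; congr expR; move: (ln _) => a; field.
  have -> : q ^+ r = expR (- (r%:R / 2 * ln (1 + s))).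
    rewrite qE1 -expRM_natl; congr expR.
    by move: (r%:R : R) (ln _) => a b; field.
  have e2 : (2^-1 : R) = expR (- ln 2) by rewrite expRN lnK// posrE.
  by rewrite e2 -expRD addrC.
rewrite ler_expR => h.
have rr : r%:R * ln (1 + s) <= rho * ln (1 + s) by rewrite ler_wpM2r.
suff : s * (\sum_(k in W k0) H k w ^+ 2) <= 2 * ln 2 + rho * ln (1 + s) by [].
move: h rr; rewrite -/H mulrAC.
move: (r%:R * ln (1 + s)) (rho * ln (1 + s)) (ln 2) (\sum_(k in _) _) => a b c Q.
by clear; lra.
Qed.

(** * Smallest eigenvalue and Rayleigh quotient *)

Section rayleigh.
Context {R : realType} (p : nat).
Implicit Types (A B : 'M[R]_p) (v w : 'rV[R]_p).

Definition qform A v : R := (v *m A *m v^T) 0 0.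

Lemma qformE A v : qform A v = \sum_i \sum_j v 0 i * A i j * v 0 j.
Proof.
rewrite /qform mxE exchange_big; apply: eq_bigr => j _.
by rewrite !mxE mulr_suml.
Qed.

Lemma qform1 v : qform 1%:M v = \sum_i v 0 i ^+ 2.
Proof. by rewrite /qform mulmx1 mxE; apply: eq_bigr => i _; rewrite mxE expr2. Qed.

Lemma qform1_ge0 v : 0 <= qform 1%:M v.
Proof. by rewrite qform1 sumr_ge0// => i _; exact: sqr_ge0. Qed.

Lemma qform1_gt0 v : v != 0 -> 0 < qform 1%:M v.
Proof.
move=> v0; rewrite lt0r qform1_ge0 andbT qform1.
apply: contra v0; rewrite psumr_eq0 => [/allP h|i _]; last exact: sqr_ge0.
apply/eqP/rowP => i; rewrite mxE; apply/eqP; rewrite -sqrf_eq0.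
exact: h (mem_index_enum i).
Qed.

Lemma qformB A (a : R) v : qform (A - a%:M) v = qform A v - a * qform 1%:M v.
Proof.
rewrite /qform mulmxBr mulmxBl mul_mx_scalar mulmx1 -scalemxAl.
by rewrite 3!mxE; congr (_ - _); rewrite mxE.
Qed.

Lemma qformZ A (a : R) v : qform A (a *: v) = a ^+ 2 * qform A v.
Proof.
by rewrite /qform -scalemxAl -scalemxAl linearZ/= -scalemxAr !mxE expr2 mulrA.
Qed.

Lemma qform_bound A : exists2 K : R, 0 < K &
  forall v, qform 1%:M v = 1 -> qform A v <= K.
Proof.
exists (1 + \sum_i \sum_j `|A i j|).
  by rewrite ltr_pwDl// sumr_ge0// => i _; rewrite sumr_ge0.
move=> v v1; rewrite qformE; apply: ler_wpDl => //.
have vi i : `|v 0 i| <= 1.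
  rewrite -(ler_pXn2r (n := 2)) ?nnegrE// expr1n real_normK ?num_real//.
  rewrite -v1 qform1 (bigD1 i)//= lerDl sumr_ge0// => j _; exact: sqr_ge0.
apply: ler_sum => i _; apply: ler_sum => j _.
apply: le_trans (ler_norm _) _; rewrite !normrM.
rewrite mulrAC -[leRHS]mul1r ler_wpM2r// mulr_ile1//.
Qed.

(** With w B = v, expanding the nonnegative value of the form at v - t w gives
    B(v, v) >= 2 t - t^2 B(w, w) on unit vectors; take t = 1 / K, where K bounds
    the form of the inverse.  This replaces compactness of the unit sphere. *)
Lemma psd_unit_coercive B : B^T = B -> B \in unitmx ->
  (forall v, 0 <= qform B v) ->
  exists2 k : R, 0 < k & forall v, qform 1%:M v = 1 -> k <= qform B v.
Proof.
move=> Bsym Bu Bpsd; have [K K0 hK] := qform_bound (invmx B)^T.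
exists K^-1; first by rewrite invr_gt0.
move=> v v1; pose w := v *m invmx B.
have wB : w *m B = v by rewrite /w mulmxKV.
have := Bpsd (v - K^-1 *: w).
have -> : qform B (v - K^-1 *: w) =
    qform B v - K^-1 * 2 + K^-1 ^+ 2 * qform (invmx B)^T v.
  have e1 : (v *m v^T) 0 0 = 1 by rewrite -v1 /qform mulmx1.
  have BwT : B *m w^T = v^T by rewrite -[in RHS]wB [in RHS]trmx_mul Bsym.
  rewrite /qform mulmxBl linearB/= linearZ/= -scalemxAl wB.
  rewrite mulmxBl mulmxBr mulmxBr -!scalemxAr -!scalemxAl.
  rewrite -(mulmxA v B w^T) BwT.
  have -> : v *m w^T = v *m (invmx B)^T *m v^T by rewrite /w trmx_mul mulmxA.
  rewrite !mxE in e1 *.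
  rewrite e1; ring.
have := hK v v1.
move: (qform _ _) (qform B v) => kap b kK.
have : K^-1 ^+ 2 * kap <= K^-1.
  have h : K^-1 * kap <= 1 by rewrite mulrC ler_pdivrMr// mul1r.
  by rewrite expr2 -mulrA ler_piMr// invr_ge0 ltW.
lra.
Qed.

(** Let m be the infimum of the Rayleigh quotient.  The form of A - m is
    nonnegative but not coercive, so A - m is singular by [psd_unit_coercive]
    and m is an eigenvalue; clearly no eigenvalue is smaller. *)
Lemma smallest_eigenvalue_rayleigh A (L : R) : (0 < p)%N -> A^T = A ->
  (forall v, L * qform 1%:M v <= qform A v) ->
  [/\ L <= smallest_eigenvalue A, eigenvalue A (smallest_eigenvalue A) &
    forall v, smallest_eigenvalue A * qform 1%:M v <= qform A v].
Proof.
move=> p0 Asym AL.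
pose E := [set qform A v | v in [set v | qform 1%:M v = 1]].
have normalize v : v != 0 -> exists2 c : R, 0 < c &
    [/\ qform 1%:M (c *: v) = 1 & c ^+ 2 * qform 1%:M v = 1].
  move=> v0; have q0 := qform1_gt0 v0.
  exists (Num.sqrt (qform 1%:M v))^-1; first by rewrite invr_gt0 sqrtr_gt0.
  by rewrite qformZ exprVn sqr_sqrtr ?ltW// mulVf// gt_eqF.
have lbE : lbound E L.
  by move=> _ [v /= v1 <-]; rewrite -[L]mulr1 -v1; exact: AL.
have E0 : E !=set0.
  have d0 : delta_mx 0 (Ordinal p0) != 0 :> 'rV[R]_p.
    apply/eqP => /rowP /(_ (Ordinal p0)); rewrite !mxE !eqxx => /eqP.
    by rewrite oner_eq0.
  have [c _ [c1 _]] := normalize _ d0.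
  by eexists; exists (c *: delta_mx 0 (Ordinal p0)).
have hiE : has_inf E by split => //; exists L.
pose m := inf E.
have mP v : m * qform 1%:M v <= qform A v.
  have [->|v0] := eqVneq v 0; first by rewrite /qform !mul0mx mxE mulr0.
  have [c c0 [c1 c2]] := normalize _ v0.
  have : m <= qform A (c *: v) by apply: ge_inf; [exact: hiE.2|exists (c *: v)].
  rewrite qformZ => h.
  by rewrite -(ler_pM2l (exprn_gt0 2 c0)) mulrCA c2 mulr1.
have Lm : L <= m by apply: lb_le_inf.
have mev : eigenvalue A m.
  rewrite /eigenvalue /eigenspace kermx_eq0 row_free_unit; apply/negP => Bu.
  have [||k k0 hk] := psd_unit_coercive _ Bu.
  - by rewrite linearB/= Asym tr_scalar_mx.
  - by move=> v; rewrite qformB subr_ge0.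
  have : m + k <= m.
    apply: lb_le_inf => // _ [v /= v1 <-].
    by have := hk v v1; rewrite qformB v1 mulr1 lerBrDl.
  by rewrite gerDl leNgt k0.
have evm a : eigenvalue A a -> m <= a.
  move=> /eigenvalueP[v vA v0].
  have := mP v; rewrite {2}/qform vA -scalemxAl mxE.
  have -> : (v *m v^T) 0 0 = qform 1%:M v by rewrite /qform mulmx1.
  rewrite ler_pM2r//.
  exact: qform1_gt0.
have -> : smallest_eigenvalue A = m.
  apply/eqP; rewrite eq_le; apply/andP; split.
    by apply: ge_inf => //; exists m => a /= /evm.
  by apply: lb_le_inf; [exists m|move=> a /= /evm].
by [].
Qed.

End rayleigh.

Lemma sample_cov_sym {R : realType} (p n : nat) (X : 'M[R]_(p, n)) :
  (sample_cov X)^T = sample_cov X.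
Proof. by rewrite /sample_cov linearZ/= trmx_mul trmxK. Qed.

Lemma qform_sample_cov {R : realType} (p n : nat) (X : 'M[R]_(p, n)) v :
  qform (sample_cov X) v = n%:R^-1 * \sum_j (\sum_i v 0 i * X i j) ^+ 2.
Proof.
rewrite /qform /sample_cov -scalemxAr -scalemxAl mxE; congr (_ * _).
have -> : v *m (X *m X^T) *m v^T = (v *m X) *m (v *m X)^T.
  by rewrite trmx_mul !mulmxA.
by rewrite mxE; apply: eq_bigr => j _; rewrite !mxE expr2.
Qed.

Lemma qform_sample_cov_ge0 {R : realType} (p n : nat) (X : 'M[R]_(p, n)) v :
  0 <= qform (sample_cov X) v.
Proof.
by rewrite qform_sample_cov mulr_ge0 ?invr_ge0// sumr_ge0// => j _; exact: sqr_ge0.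
Qed.

Lemma smallest_eigenvalue_ge0 {R : realType} (p n : nat) (X : 'M[R]_(p, n)) :
  (0 < p)%N -> 0 <= smallest_eigenvalue (sample_cov X).
Proof.
move=> p0; have [|//] :=
  @smallest_eigenvalue_rayleigh R p (sample_cov X) 0 p0 (sample_cov_sym X).
by move=> v; rewrite mul0r qform_sample_cov_ge0.
Qed.

(** * Measurability of the smallest eigenvalue *)

Lemma continuous_qform {R : realType} (p : nat) (B : 'M[R]_p) :
  continuous (qform B).
Proof.
have -> : qform B = fun v => \sum_i \sum_j v 0 i * B i j * v 0 j.
  by apply/funext => u; exact: qformE.
apply: continuous_big => [|i _]; first exact: (@add_continuous R).
apply: continuous_big => [|j _]; first exact: (@add_continuous R).
move=> v.
have c k : (u : 'rV[R]_p) 0 k @[u --> v] --> v 0 k by exact: coord_continuous.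
exact: (cvgM (cvgM (c i) (cvg_cst _)) (c j)).
Qed.

Lemma qform_neg_rational {R : realType} (p : nat) (B : 'M[R]_p) (v : 'rV[R]_p) :
  qform B v < 0 -> exists u : 'rV[rat]_p, qform B (map_mx ratr u) < 0.
Proof.
move=> Bv.
have : \forall u \near v, qform B u < 0.
  exact: (cvgr_lt (qform B v) (@continuous_qform R p B v) 0 Bv).
move=> /nbhs_ballP[eps /= eps0 near].
have ratE i : exists r : rat, ball (v 0 i) eps (ratr r : R).
  have [|r hr] := @rat_in_itvoo R (v 0 i) (v 0 i + eps); first by rewrite ltrDl.
  exists r; move: hr; rewrite inE/= => /itvP h; rewrite /ball/= ltr_distlC.
  by rewrite !h andbT (lt_trans _ (_ : v 0 i < _)) ?h// ltrBlDr ltrDl.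
have [f hf] := choice ratE.
exists (\row_i f i); apply: near; split => // i j.
by rewrite !mxE ord1; exact: hf.
Qed.

(** The eigenvalue is less than t iff the form of M - t is negative somewhere,
    hence, by continuity, at one of countably many rational vectors. *)
Lemma measurable_smallest_eigenvalue {R : realType} {d : measure_display}
    {T : measurableType d} (p : nat) (M : T -> 'M[R]_p) : (0 < p)%N ->
  (forall i j, measurable_fun setT (fun w => M w i j)) ->
  (forall w, (M w)^T = M w) -> (forall w v, 0 <= qform (M w) v) ->
  measurable_fun setT (fun w => smallest_eigenvalue (M w)).
Proof.
move=> p0 mM Msym Mpsd.
apply: (measurability _ (RGenInftyO.measurableE R)) => //.
move=> _ [_ [t ->] <-]; rewrite setTI.
have ray w := @smallest_eigenvalue_rayleigh R p (M w) 0 p0 (Msym w).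
have -> : (fun w => smallest_eigenvalue (M w)) @^-1` `]-oo, t[%classic =
    \bigcup_(u : 'rV[rat]_p) [set w | qform (M w - t%:M) (map_mx ratr u) < 0].
  apply/seteqP; split => w /=; rewrite in_itv/=.
    move=> lt.
    have [|_ /eigenvalueP[v vA v0] _] := ray w.
      by move=> v; rewrite mul0r.
    have [|u hu] := @qform_neg_rational _ _ (M w - t%:M) v.
      rewrite qformB {1}/qform vA -scalemxAl mxE.
      have -> : (v *m v^T) 0 0 = qform 1%:M v by rewrite /qform mulmx1.
      by rewrite subr_lt0 ltr_pM2r// qform1_gt0.
    by exists u.
  move=> [u _ /=]; rewrite qformB subr_lt0 => h.
  have [|_ _ /(_ (map_mx ratr u)) h2] := ray w; first by move=> v; rewrite mul0r.
  have := le_lt_trans h2 h; rewrite ltr_pM2r//.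
  rewrite lt0r qform1_ge0 andbT; apply/eqP => q0.
  by move: (le_lt_trans (Mpsd w _) h); rewrite q0 mulr0 ltxx.
apply: countable_bigcupT_measurable => // u.
rewrite (_ : [set w | _] =
    (fun w => qform (M w - t%:M) (map_mx ratr u) < 0) @^-1` [set true]);
  last by apply/seteqP; split.
rewrite -[X in measurable X]setTI; apply: measurable_fun_ltr => //.
under eq_fun do rewrite qformE.
apply: measurable_sum => i; apply: measurable_sum => j.
apply: measurable_funM => //; apply: measurable_funM => //.
under eq_fun do rewrite mxE mxE.
by apply: measurable_funB => //; exact: mM.
Qed.

(** * Both ensembles as blocks of a circulant matrix *)

Lemma iid_std_normal_reindex {R : realType} {d : measure_display}
    {T : measurableType d} (P : probability T R) (I J : choiceType)
    (x : J -> {RV P >-> R}) (f : I -> J) (g : J -> I) : cancel f g ->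
  iid_std_normal x -> iid_std_normal (fun i => x (f i)).
Proof.
move=> fK [xi xn]; split; last by move=> i; exact: xn.
move=> s B us mB.
have := xi (map f s) (fun j => B (g j)).
rewrite map_inj_uniq; last exact: can_inj fK.
have mB' j : j \in map f s -> measurable (B (g j)).
  by move=> /mapP[i si ->]; rewrite fK; exact: mB.
move=> /(_ us mB'); rewrite big_map !bigcap_seq big_map.
under eq_bigr do rewrite fK.
by under [X in _ = X -> _]eq_bigr do rewrite fK.
Qed.

Lemma val_ord_sub (N' : nat) (a b : 'I_N'.+1) :
  val (a - b) = (if b <= a then a - b else N'.+1 + a - b)%N.
Proof.
have aN := ltn_ord a; have bN := ltn_ord b.
rewrite /= modnDmr addnBA ?(ltnW bN)//; case: leqP => ab.
  rewrite [(a + _)%N]addnC -addnBA// modnDl modn_small//.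
  exact: leq_ltn_trans (leq_subr _ _) aN.
rewrite [(a + _)%N]addnC modn_small// ltn_subLR; last first.
  exact: leq_trans (ltnW bN) (leq_addr _ _).
by rewrite [(_ + a)%N]addnC ltn_add2r.
Qed.

(** The indices j - i of a Toeplitz matrix range over an interval of n + p - 1
    integers, which are distinct modulo n + p; so its entries are those of the
    first n columns of a circulant matrix of order n + p. *)
Lemma ensemble_embedding (e : ensemble) (p n : nat) : (0 < p <= n)%N ->
  exists N' (f : 'I_N'.+1 -> int) (g : int -> 'I_N'.+1),
  [/\ cancel f g, (n <= N'.+1 <= n + p)%N &
    forall (R : realType) (x : int -> R) (i : 'I_p) (j : 'I_n)
      (i' j' : 'I_N'.+1), val i' = i -> val j' = j ->
      ensemble_mx e p n x i j = x (f (j' - i'))].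
Proof.
move=> /andP[p0 pn]; have n0 : (0 < n)%N by exact: leq_trans pn.
case: e.
  pose N' := (n + p).-1; have NE : N'.+1 = (n + p)%N by rewrite prednK// addn_gt0 n0.
  pose f (k : 'I_N'.+1) : int := if (k < n)%N then k%:Z else k%:Z - (n + p)%:Z.
  pose g (z : int) : 'I_N'.+1 :=
    if 0 <= z then inord `|z|%N else inord (absz (z + (n + p)%:Z)).
  exists N', f, g; split.
  - move=> k; have kN := ltn_ord k; rewrite /f /g; case: (ltnP k n) => kn.
      by rewrite /= inord_val.
    have -> : (0 <= k%:Z - (n + p)%:Z) = false.
      by apply/negbTE; rewrite -ltNge subr_lt0 ltz_nat -NE.
    by rewrite subrK /= inord_val.
  - by rewrite NE leq_addr leqnn.
  move=> R x i j i' j' ii jj; rewrite /ensemble_mx mxE; congr x.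
  have iN := ltn_ord i; have jN := ltn_ord j.
  rewrite /f val_ord_sub ii jj NE; case: (leqP i j) => ij.
    by rewrite (leq_ltn_trans (leq_subr _ _) jN) subzn.
  have h : (i <= n + p + j)%N.
    by apply: leq_trans (ltnW iN) _; rewrite -addnA addnCA leq_addr.
  have -> : (n + p + j - i < n)%N = false.
    apply/negbTE; rewrite -leqNgt leq_subRL// [(i + n)%N]addnC -addnA.
    by rewrite leq_add2l (leq_trans (ltnW iN))// leq_addr.
  rewrite -subzn// !PoszD; ring.
have [N' NE] : exists N', n = N'.+1 by exists n.-1; rewrite prednK.
subst n; exists N', (fun k => k%:Z), (fun z => inord `|z|%N); split.
- by move=> k; rewrite /= inord_val.
- by rewrite leqnn leq_addr.
move=> R x i j i' j' ii jj; rewrite /ensemble_mx mxE; congr x.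
have iN := ltn_ord i; have jN := ltn_ord j.
rewrite val_ord_sub ii jj; case: (leqP i j) => ij.
  rewrite subzn// modz_small//= ltz_nat.
  exact: leq_ltn_trans (leq_subr _ _) jN.
have h : (i <= N'.+1 + j)%N.
  by apply: leq_trans (leq_addr _ _); exact: leq_trans (ltnW iN) pn.
rewrite -(modzDl (j%:Z - i%:Z)) addrA -PoszD subzn// modz_small//= ltz_nat.
by rewrite ltn_subLR// addnC ltn_add2r.
Qed.

Lemma sum_ord_widen {V : nmodType} (p N : nat) (pN : (p <= N)%N) (F : 'I_N -> V) :
  (forall i : 'I_N, (p <= i)%N -> F i = 0) ->
  \sum_i F i = \sum_(i < p) F (widen_ord pN i).
Proof.
move=> F0; rewrite (bigID (fun i : 'I_N => (i < p)%N))/= [X in _ + X]big1.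
  by rewrite addr0 (big_ord_narrow pN).
by move=> i; rewrite -leqNgt; exact: F0.
Qed.

(** * Elementary estimates and choice of parameters *)

(** Apply [circulant_small_ball] to the ambient circulant matrix: its additional
    columns only increase |X^T v|^2. *)
Lemma ensemble_small_ball {R : realType} (e : ensemble) {d : measure_display}
    {T : measurableType d} (P : probability T R) (x : int -> {RV P >-> R})
    (p n l m : nat) : iid_std_normal x ->
  (0 < p <= n)%N -> (0 < l <= p)%N -> (m.+1 * l.-1 < p)%N ->
  exists2 N : nat, (n <= N <= n + p)%N &
  forall s rho : R, 0 < s -> 8 * N%:R / l%:R <= rho ->
  exists A : set T, [/\ measurable A,
    (P A <= (4 * rho ^+ 2 * expR (rho * ln (1 + s)) / N%:R +
             2 * expR (1 / 2) / N%:R)%:E)%E &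
    forall w, ~ A w ->
      n%:R * smallest_eigenvalue
        (sample_cov (ensemble_mx e p n (fun k : int => x k w))) <=
      N%:R * ((2 * ln 2 + rho * ln (1 + s)) / s +
        4^-1 ^+ m * (N%:R / l%:R) * (2 * ln N%:R) ^+ 2)].
Proof.
move=> iid pn /andP[l0 lp] mp; have /andP[p0 pn'] := pn.
have [N' [f [g [fK nN ent]]]] := ensemble_embedding e pn.
have /andP[nN' _] := nN.
have pN : (p <= N'.+1)%N := leq_trans pn' nN'.
exists N'.+1 => // s rho s0 hrho.
have iidy := iid_std_normal_reindex fK iid.
have [A [mA PA hA]] := circulant_small_ball iidy l0 (leq_trans lp pN) pN mp s0 hrho.
exists A; split => // w nAw.
set X := ensemble_mx _ _ _ _.
have [|lam0 _ ray] :=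
  @smallest_eigenvalue_rayleigh R p (sample_cov X) 0 p0 (sample_cov_sym X).
  by move=> v; rewrite mul0r qform_sample_cov_ge0.
have n0 : 0 < n%:R :> R by rewrite ltr0n (leq_trans p0).
apply: hA nAw _ _; first by rewrite mulr_ge0.
move=> v v0.
pose u : 'rV[R]_p := \row_i v (widen_ord pN i).
rewrite (sum_ord_widen pN); last by move=> i pi; rewrite v0// expr0n.
rewrite (eq_bigr (fun i => u 0 i ^+ 2)); last by move=> i _; rewrite mxE.
apply: le_trans (_ : _ <= \sum_j (\sum_i u 0 i * X i j) ^+ 2) _.
  by have := ray u; rewrite qform1 qform_sample_cov ler_pdivlMl// mulrA.
rewrite [leRHS](bigID (fun j : 'I_N'.+1 => (j < n)%N))/= ler_wpDr//.
  by apply: sumr_ge0 => j _; exact: sqr_ge0.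
rewrite (big_ord_narrow nN')/=; apply: ler_sum => j _.
rewrite (_ : \sum_i u 0 i * X i j = \sum_i v i * x (f (widen_ord nN' j - i)) w)//.
rewrite [RHS](sum_ord_widen pN); last by move=> i pi; rewrite v0// mul0r.
apply: eq_bigr => i _; rewrite mxE; congr (_ * _).
exact: (ent R (fun k => x k w) i j (widen_ord pN i) (widen_ord nN' j)).
Qed.

Lemma expR_ge_pow {R : realType} (k : nat) (t : R) : (0 < k)%N -> 0 <= t ->
  (t / k%:R) ^+ k <= expR t.
Proof.
move=> k0 t0.
have -> : expR t = expR (t / k%:R) ^+ k.
  by rewrite -expRM_natl mulrC divfK// pnatr_eq0 -lt0n.
apply: lerXn2r; rewrite ?nnegrE ?expR_ge0 ?divr_ge0//.
by apply: le_trans (expR_ge1Dx _); rewrite lerDr.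
Qed.

(** From exp(c t) >= (c t / (k + 1))^(k + 1). *)
Lemma pow_expRN_le {R : realType} (k : nat) (c t : R) : 0 < c -> 0 < t ->
  t ^+ k * expR (- (c * t)) <= (k.+1%:R / c) ^+ k.+1 / t.
Proof.
move=> c0 t0.
have h := @expR_ge_pow R k.+1 (c * t) isT (ltW (mulr_gt0 c0 t0)).
rewrite expRN ler_pdivrMr ?expR_gt0//.
apply: le_trans (_ : (k.+1%:R / c) ^+ k.+1 / t * (c * t / k.+1%:R) ^+ k.+1 <= _).
  rewrite mulrAC -exprMn (_ : _ / c * _ = t).
    by rewrite exprS mulrC mulrA mulVf ?mul1r// gt_eqF.
  have : k.+1%:R != 0 :> R by rewrite pnatr_eq0.
  by move: (k.+1%:R : R) => a a0; field; rewrite a0 gt_eqF.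
apply: ler_wpM2l => //; apply: divr_ge0; last exact: ltW.
by rewrite exprn_ge0// divr_ge0// ltW.
Qed.

(** 4 >= exp(3/4), and the exponent 3/4 is shared: 1/4 for the rate exp(- L / 4)
    and 1/2 to absorb polynomial factors in m. *)
Lemma quarter_pow_le {R : realType} (m : nat) (L : R) : L <= m.+1%:R ->
  4^-1 ^+ m <= 4 * (expR (- (4^-1 * L)) * expR (- (2^-1 * m.+1%:R))) :> R.
Proof.
move=> LM.
have q : 4^-1 <= expR (- (3 / 4)) :> R.
  by apply: le_trans (expR_ge1Dx _); lra.
have -> : 4^-1 ^+ m = 4 * 4^-1 ^+ m.+1 :> R by rewrite exprS mulrA mulfV ?mul1r.
rewrite ler_pM2l// -expRD.
apply: le_trans (lerXn2r m.+1 _ _ q) _; rewrite ?nnegrE ?expR_ge0//.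
rewrite -expRM_natl ler_expR; lra.
Qed.

Lemma ln_add1_pow4 {R : realType} (m : nat) :
  ln (1 + 4 ^+ m) <= 3 * m.+1%:R :> R.
Proof.
have s1 : 1 <= 4 ^+ m :> R by apply: exprn_ege1; rewrite ler1n.
have s0 : 0 < 1 + 4 ^+ m :> R by lra.
apply: (@le_trans _ _ (ln (4 ^+ m.+1))).
  by rewrite ler_ln ?posrE ?exprn_gt0// exprS; lra.
have -> : ln (4 ^+ m.+1) = m.+1%:R * ln 4 :> R by rewrite lnXn// -[LHS]mulr_natl.
rewrite mulrC; apply: ler_wpM2r => //.
have -> : 4 = 1 + 3 :> R by lra.
by apply: le_ln1Dx; lra.
Qed.

(** The left side is the exponent in the failure probability of the second
    moment method, with M to spare; the right side is a lower bound of ln p. *)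
Lemma cube_dominates {R : realType} (B M : R) : 0 <= B -> 768 * B + 4 <= M ->
  48 * B * M ^+ 2 + M <= M ^+ 3 / 8.
Proof.
move=> B0 BM; have M4 : 4 <= M by lra.
have M16 : 16 <= M ^+ 2 by nra.
have h1 : 48 * B * M ^+ 2 <= M / 16 * M ^+ 2.
  by apply: ler_wpM2r; [exact: sqr_ge0|lra].
have h2 : 1 * M <= M ^+ 2 / 16 * M by apply: ler_wpM2r; lra.
by rewrite [M ^+ 3]exprSr; lra.
Qed.

Lemma div_bounds (p m : nat) : (m < p)%N ->
  let l := (p %/ m.+1)%N in
  [/\ (0 < l <= p)%N, (m.+1 * l.-1 < p)%N & (p <= 2 * m.+1 * l)%N].
Proof.
move=> mp l; have l0 : (0 < l)%N by rewrite divn_gt0.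
split.
- by rewrite l0 leq_div.
- apply: leq_trans (leq_trunc_div p m.+1); rewrite mulnC ltn_pmul2r//.
  by rewrite prednK.
apply: leq_trans (ltnW (ltn_ceil p (ltn0Sn m))) _.
by rewrite mulnC -mulnA mulnCA leq_mul2l/= mul2n -addnn -addn1 leq_add2l.
Qed.

(** Take s = 4^m and l = p / (m + 1).  Then 8 N / l <= rho = 16 B M and
    ln(1 + s) <= 3 M, so that the exceptional probability is at most
    O(M^2) exp(48 B M^2 - M^3 / 8) and the eigenvalue at most O(M^7) 4^-m. *)
Lemma smallest_eigenvalue_rate {R : realType} (B : R) : 1 <= B ->
  exists2 C : R, 0 < C &
  forall (e : ensemble) (d : measure_display) (T : measurableType d)
    (P : probability T R) (x : int -> {RV P >-> R}) (p n m : nat),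
  let L := (ln (p%:R : R)) `^ 3%:R^-1 in
  let M := m.+1%:R : R in
  iid_std_normal x -> (0 < p <= n)%N -> (n + p)%:R <= B * p%:R ->
  M - 2 <= L <= M -> C <= M ->
  exists A : set T, [/\ measurable A, (P A <= (C / M)%:E)%E &
    forall w, ~ A w ->
      smallest_eigenvalue
        (sample_cov (ensemble_mx e p n (fun k : int => x k w))) <=
      expR (- (4^-1 * L)) * (C / M)].
Proof.
move=> B1.
have B0 : 0 < B by lra.
have BB : 0 < B ^+ 2 by exact: exprn_gt0.
have BB1 : 0 < B * (B + 1) ^+ 2 by apply: mulr_gt0 => //; apply: exprn_gt0; lra.
have e0 : 0 < expR (1 / 2) :> R by exact: expR_gt0.
pose D : R := 2 + 48 * B + 8 * (B * (B + 1) ^+ 2).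
have D0 : 0 < D by rewrite /D; lra.
have [K8 K80 K8P] : exists2 K8 : R, 0 < K8 &
    forall t : R, 0 < t -> t ^+ 7 * expR (- (2^-1 * t)) <= K8 / t.
  exists ((8 / 2^-1) ^+ 8) => [|t t0]; first by rewrite exprn_gt0 ?divr_gt0 ?invr_gt0.
  by apply: pow_expRN_le => //; rewrite invr_gt0.
pose b16 := 16 * B.
have b160 : 0 < b16 by rewrite /b16; lra.
pose C1 : R := 4 * b16 ^+ 2 * 27 + 2 * expR (1 / 2).
pose C2 : R := 8 * D * K8.
have C10 : 0 < C1.
  have : 0 < b16 ^+ 2 by exact: exprn_gt0.
  by rewrite /C1; lra.
have C20 : 0 < C2 by apply: mulr_gt0 => //; lra.
exists (C1 + C2 + 768 * B + 4); first by lra.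
set C := C1 + _ + _ + _.
move=> e d T P x p n m L M iid pn nB /andP[ML LM] CM.
have /andP[p0 pn'] := pn.
have pR0 : 0 < p%:R :> R by rewrite ltr0n.
have M768 : 768 * B + 4 <= M by rewrite /C in CM; lra.
have CC1 : C1 <= C by rewrite /C; lra.
have CC2 : C2 <= C by rewrite /C; lra.
move: C {CM} CC1 CC2 => C CC1 CC2.
have M4 : 4 <= M by lra.
have M0 : 0 < M by lra.
have lnp : ln p%:R = L ^+ 3.
  rewrite -powR_mulrn ?powR_ge0// -powRrM mulVf ?pnatr_eq0// powRr1//.
  by rewrite ln_ge0// ler1n.
have ML3 : M ^+ 3 / 8 <= ln p%:R.
  rewrite lnp; apply: (@le_trans _ _ ((M / 2) ^+ 3)).
    by rewrite exprMn; lra.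
  by apply: lerXn2r; rewrite ?nnegrE; lra.
have pE : expR (M ^+ 3 / 8) <= p%:R by rewrite -[leRHS]lnK// ler_expR.
have cube := cube_dominates (ltW B0) M768.
have MM3 : M <= M ^+ 3 / 8.
  by apply: le_trans cube; rewrite lerDr !mulr_ge0// ?exprn_ge0// ltW.
have mp : (m < p)%N.
  rewrite -(ltr_nat R) -(ltrD2r 1) natr1 -/M.
  apply: le_lt_trans (_ : p%:R < _); last by rewrite ltrDl.
  apply: le_trans pE; apply: le_trans (_ : expR M <= _); last by rewrite ler_expR.
  by apply: le_trans (expR_ge1Dx _); rewrite lerDr.
have [lp lmp pl] := div_bounds mp.
set l := (p %/ m.+1)%N in lp lmp pl.
have /andP[l0 _] := lp.
have lR0 : 0 < l%:R :> R by rewrite ltr0n.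
have [N /andP[nN Nnp] hN] := ensemble_small_ball e iid pn lp lmp.
have pN : (p <= N)%N := leq_trans pn' nN.
have NB : N%:R <= B * p%:R :> R by apply: le_trans nB; rewrite ler_nat.
have pNR : p%:R <= N%:R :> R by rewrite ler_nat.
have NR0 : 0 < N%:R :> R by lra.
have nR0 : 0 < n%:R :> R by rewrite ltr0n (leq_trans p0).
have Nn : N%:R <= 2 * n%:R :> R.
  rewrite -natrM ler_nat; apply: leq_trans Nnp _.
  by rewrite mul2n -addnn leq_add2l.
have Nl : N%:R / l%:R <= 2 * B * M.
  rewrite ler_pdivrMr//; apply: le_trans NB _.
  have : p%:R <= 2 * M * l%:R :> R by rewrite -!natrM ler_nat.
  by move=> h; rewrite mulrAC -mulrA -[leRHS]mulrA mulrCA ler_pM2l//; lra.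
pose s : R := 4 ^+ m.
have s0 : 0 < s by rewrite exprn_gt0.
pose rho := 16 * B * M.
have rho0 : 0 <= rho by rewrite !mulr_ge0 ?ltW.
have lns : ln (1 + s) <= 3 * M by exact: ln_add1_pow4.
have lns0 : 0 <= ln (1 + s).
  by apply: ln_ge0; rewrite lerDl ltW.
have rl : rho * ln (1 + s) <= 48 * B * M ^+ 2.
  apply: le_trans (ler_wpM2l rho0 lns) _.
  by rewrite /rho expr2; lra.
have [|A [mA PA hA]] := hN s rho s0.
  by rewrite /rho; lra.
exists A; split => //.
- apply: le_trans PA _; rewrite lee_fin.
  have expM : expR (rho * ln (1 + s)) / N%:R <= expR (- M).
    rewrite ler_pdivrMr//; apply: le_trans (_ : expR (- M) * expR (M ^+ 3 / 8) <= _).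
      rewrite -expRD ler_expR; apply: le_trans rl _.
      by rewrite addrC lerBrDr.
    by rewrite ler_pM2l ?expR_gt0//; lra.
  have expM1 : 1 / N%:R <= expR (- M).
    apply: le_trans _ expM; rewrite ler_pM2r ?invr_gt0// -[leLHS]expR0 ler_expR.
    by rewrite mulr_ge0.
  have e1 : expR (- M) <= 1 / M.
    have := @pow_expRN_le R 0 1 M ltr01 M0.
    by rewrite !(expr0, mul1r, invr1, expr1, div1r).
  have e2 : M ^+ 2 * expR (- M) <= 27 / M.
    have := @pow_expRN_le R 2 1 M ltr01 M0.
    by rewrite mul1r divr1 -natrX.
  apply: (@le_trans _ _ (C1 / M)); last first.
    by rewrite ler_pM2r ?invr_gt0.
  rewrite /C1 [leRHS]mulrDl; apply: lerD.
    apply: (@le_trans _ _ (4 * rho ^+ 2 * expR (- M))).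
      rewrite -mulrA; apply: ler_wpM2l => //.
      by rewrite mulr_ge0// sqr_ge0.
    have -> : 4 * rho ^+ 2 * expR (- M) = 4 * b16 ^+ 2 * (M ^+ 2 * expR (- M)).
      by rewrite /rho -/b16 exprMn !mulrA.
    rewrite -[leRHS]mulrA; apply: ler_wpM2l => //.
    by rewrite mulr_ge0// sqr_ge0.
  apply: (@le_trans _ _ (2 * expR (1 / 2) * (1 / N%:R))).
    by rewrite [1 / N%:R]mul1r.
  rewrite -[M^-1]mul1r; apply: ler_wpM2l; first by rewrite mulr_ge0// expR_ge0.
  exact: le_trans expM1 e1.
move=> w nAw; have {hA} := hA w nAw.
set lam := smallest_eigenvalue _; set X := (X in _ <= _ * X).
have lnN0 : 0 <= ln N%:R :> R by rewrite ln_ge0// ler1n (leq_trans p0).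
have lnN : ln N%:R <= (B + 1) * M ^+ 3.
  apply: (@le_trans _ _ (ln B + ln p%:R)).
    by rewrite -lnM// ler_ln// posrE mulr_gt0.
  have lnB : ln B <= B by apply/ltW; apply: ln_sublinear.
  have lnpM : ln p%:R <= M ^+ 3.
    by rewrite lnp; apply: lerXn2r; rewrite ?nnegrE//; lra.
  have M31 : 1 <= M ^+ 3 by apply: exprn_ege1; lra.
  nra.
have lnN2 : (2 * ln N%:R) ^+ 2 <= 4 * (B + 1) ^+ 2 * M ^+ 6.
  have -> : 4 * (B + 1) ^+ 2 * M ^+ 6 = (2 * ((B + 1) * M ^+ 3)) ^+ 2 by ring.
  have b1 : 0 <= 2 * ln N%:R :> R by rewrite mulr_ge0.
  have b2 : 2 * ln N%:R <= 2 * ((B + 1) * M ^+ 3) by rewrite ler_pM2l.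
  by apply: lerXn2r; rewrite ?nnegrE// (le_trans b1).
have XD : X <= 4^-1 ^+ m * (D * M ^+ 7).
  have -> : X = 4^-1 ^+ m * (2 * ln 2 + rho * ln (1 + s) +
      N%:R / l%:R * (2 * ln N%:R) ^+ 2).
    have sV : s^-1 = 4^-1 ^+ m by rewrite /s exprVn.
    rewrite /X sV [RHS]mulrDr [in RHS]mulrA; congr (_ + _).
    exact: mulrC.
  apply: ler_wpM2l; first by rewrite exprn_ge0.
  rewrite /D [leRHS]mulrDl; apply: lerD; last first.
    have -> : 8 * (B * (B + 1) ^+ 2) * M ^+ 7 =
        2 * B * M * (4 * (B + 1) ^+ 2 * M ^+ 6) by ring.
    by apply: ler_pM => //; rewrite ?divr_ge0 ?sqr_ge0// ltW.
  rewrite [leRHS]mulrDl.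
  have ln2 : ln 2 <= 1 :> R.
    have -> : 2 = 1 + 1 :> R by lra.
    by apply: le_ln1Dx; lra.
  have M71 : 1 <= M ^+ 7 by apply: exprn_ege1; lra.
  have M27 : M ^+ 2 <= M ^+ 7 by rewrite ler_weXn2l//; lra.
  apply: lerD; first by lra.
  by apply: le_trans rl _; apply: ler_wpM2l => //; lra.
have X0 : 0 <= 4^-1 ^+ m * (D * M ^+ 7).
  by rewrite mulr_ge0 ?exprn_ge0// mulr_ge0 ?exprn_ge0 ?ltW.
move=> hlam.
have lamX : lam <= 2 * (4^-1 ^+ m * (D * M ^+ 7)).
  rewrite -(ler_pM2l nR0); apply: le_trans hlam _.
  apply: le_trans (ler_wpM2l (ltW NR0) XD) _.
  by rewrite [leRHS]mulrA; apply: ler_wpM2r => //; rewrite mulrC.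
apply: le_trans lamX _.
have e7 : M ^+ 7 * expR (- (2^-1 * M)) <= K8 / M.
  exact: K8P.
apply: (@le_trans _ _ (expR (- (4^-1 * L)) * (C2 / M))); last first.
  by rewrite ler_pM2l ?expR_gt0// ler_pM2r ?invr_gt0.
apply: (@le_trans _ _ (2 * ((4 * (expR (- (4^-1 * L)) * expR (- (2^-1 * M)))) *
    (D * M ^+ 7)))).
  rewrite ler_pM2l// ler_wpM2r ?quarter_pow_le//.
  by rewrite mulr_ge0 ?exprn_ge0 ?ltW.
have -> : 2 * (4 * (expR (- (4^-1 * L)) * expR (- (2^-1 * M))) * (D * M ^+ 7)) =
    expR (- (4^-1 * L)) * (8 * D * (M ^+ 7 * expR (- (2^-1 * M)))) by ring.
rewrite ler_pM2l ?expR_gt0//.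
have -> : C2 / M = 8 * D * (K8 / M) by rewrite /C2 mulrA.
by rewrite ler_pM2l//; apply: mulr_gt0 => //; lra.
Qed.

(** * Convergence in probability *)

Lemma measurable_ensemble_eigenvalue {R : realType} (e : ensemble)
    {d : measure_display} {T : measurableType d} {P : probability T R}
    (x : int -> {RV P >-> R}) (p n : nat) : (0 < p)%N ->
  measurable_fun setT (fun w => smallest_eigenvalue
    (sample_cov (ensemble_mx e p n (fun k : int => x k w)))).
Proof.
move=> p0; apply: measurable_smallest_eigenvalue => //.
- move=> i j; under eq_fun do rewrite mxE mxE.
  apply: measurable_funM => //; apply: measurable_sum => k.
  have mX i' : measurable_fun setT
      (fun w => ensemble_mx e p n (fun k : int => x k w) i' k).
    by case: e; under eq_fun do rewrite mxE; exact: measurable_RV.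
  by under eq_fun do rewrite [_^T _ _]mxE; exact: measurable_funM.
- by move=> w; exact: sample_cov_sym.
- by move=> w v; exact: qform_sample_cov_ge0.
Qed.

Lemma log_cbrt_large {R : realType} (K : R) : 0 <= K ->
  \forall p \near \oo, K <= (ln (p%:R : R)) `^ 3%:R^-1.
Proof.
move=> K0; near=> p.
have pK : expR (K ^+ 3) <= p%:R by near: p; exact: nbhs_infty_ger.
have lnp : K ^+ 3 <= ln p%:R.
  by rewrite -ler_expR lnK// posrE (lt_le_trans (expR_gt0 _) pK).
have -> : K = (K ^+ 3) `^ 3%:R^-1.
  by rewrite -powR_mulrn// -powRrM mulfV ?pnatr_eq0// powRr1.
apply: ge0_ler_powR => //; rewrite nnegrE ?exprn_ge0//.
by apply: le_trans lnp; rewrite exprn_ge0.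
Unshelve. all: by end_near. Qed.

Theorem theorem1 (R : realType) (c : R) (hc : 0 < c <= 1) (e : ensemble) :
  exists2 beta : R, 0 < beta &
  forall (n : nat -> nat) (hn : forall p : nat, (p <= n p)%N)
    (hlim : (p%:R / (n p)%:R : R) @[p --> \oo] --> c)
    (d : measure_display) (T : measurableType d) (P : probability T R)
    (x : int -> {RV P >-> R}) (hx : iid_std_normal x),
  littleo_P P
    (fun p w => smallest_eigenvalue
       (sample_cov (ensemble_mx e p (n p) (fun k : int => x k w))))
    (fun p => expR (- beta * (ln (p%:R : R)) `^ (3%:R^-1))).
Proof.
have /andP[c0 c1] := hc.
pose B : R := 2 / c + 1.
have B1 : 1 <= B by rewrite lerDr divr_ge0// ltW.
have [C C0 rate] := smallest_eigenvalue_rate B1.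
exists 4^-1; first by rewrite invr_gt0.
move=> n hn hlim d T P x hx eps eps0.
pose L p := (ln (p%:R : R)) `^ 3%:R^-1.
pose lam p w := smallest_eigenvalue
  (sample_cov (ensemble_mx e p (n p) (fun k : int => x k w))).
pose E p := [set w | eps < `|lam p w / expR (- 4^-1 * L p) - 0|].
have mE p : (0 < p)%N -> measurable (E p).
  move=> p0; rewrite (_ : E p = (fun w =>
      eps < `|lam p w / expR (- 4^-1 * L p) - 0|) @^-1` [set true]); last first.
    by apply/seteqP; split.
  rewrite -[X in measurable X]setTI; apply: measurable_fun_ltr => //.
  apply: measurableT_comp => //; apply: measurable_funB => //.
  apply: measurable_funM => //; exact: measurable_ensemble_eigenvalue.
have bound (delta : R) : 0 < delta ->
    \forall p \near \oo, (0 < p)%N /\ (P (E p) <= delta%:E)%E.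
  move=> delta0; pose K := C + C / delta + C / eps.
  have CK : C <= K by rewrite /K -addrA lerDl addr_ge0// divr_ge0 ?ltW.
  have CdK : C / delta <= K.
    by rewrite /K addrAC lerDr addr_ge0 ?divr_ge0 ?ltW.
  have CeK : C / eps <= K by rewrite /K lerDr addr_ge0 ?divr_ge0 ?ltW.
  near=> p.
  have p0 : (0 < p)%N by near: p; exact: nbhs_infty_gt.
  split => //.
  have pR0 : 0 < p%:R :> R by rewrite ltr0n.
  have nR0 : 0 < (n p)%:R :> R by rewrite ltr0n (leq_trans p0).
  have npB : (n p + p)%:R <= B * p%:R :> R.
    have : c / 2 < p%:R / (n p)%:R.
      near: p; apply: (cvgr_gt c hlim); rewrite ltr_pdivrMr//; lra.
    rewrite ltr_pdivlMr// natrD /B mulrDl mul1r lerD2r => h.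
    rewrite mulrAC ler_pdivlMr//; lra.
  have KL : K <= L p.
    near: p; apply: log_cbrt_large; apply: le_trans CK; exact: ltW.
  have L0 : 0 <= L p by exact: powR_ge0.
  pose m := Num.truncn (L p).
  have /andP[mL Lm] := truncn_itv L0.
  have KM : K <= m.+1%:R by apply: le_trans KL (ltW Lm).
  have M0 : 0 < m.+1%:R :> R by rewrite ltr0n.
  have [||||A [mA PA hA]] := rate e d T P x p (n p) m hx.
  - by rewrite p0 hn.
  - exact: npB.
  - rewrite (ltW Lm) andbT; apply: le_trans mL.
    by rewrite -natr1 -/m; lra.
  - exact: le_trans CK KM.
  apply: (@le_trans _ _ (P A)).
    apply: le_measure; rewrite ?inE//; first exact: mE.
    move=> w /=; rewrite /E /= subr0 => epsw.
    have [//|nA] := pselect (A w); exfalso; move: epsw.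
    apply/negP; rewrite -leNgt ger0_norm; last first.
      by rewrite divr_ge0 ?expR_ge0// smallest_eigenvalue_ge0.
    rewrite ler_pdivrMr ?expR_gt0//.
    apply: le_trans (hA w nA) _; rewrite mulrC mulNr.
    apply: ler_wpM2r; first exact: expR_ge0.
    by rewrite ler_pdivrMr// mulrC -ler_pdivrMr// (le_trans CeK).
  apply: le_trans PA _; rewrite lee_fin ler_pdivrMr// mulrC -ler_pdivrMr//.
  exact: le_trans CdK KM.
apply/fine_cvgP; split.
  near=> p; apply: fin_num_measure; apply: mE.
  by near: p; exact: nbhs_infty_gt.
apply/cvgr0Pnorm_le => delta delta0.
near=> p.
have [p0 PE] : (0 < p)%N /\ (P (E p) <= delta%:E)%E.
  by near: p; exact: bound.
rewrite /= ger0_norm ?fine_ge0//.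
by rewrite -lee_fin fineK// fin_num_measure//; exact: mE.
Unshelve. all: by end_near. Qed.
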